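(* Let $a=0$ (ReLU activation) and let $s>0$ be real. Define $$I_0(s,d)=2^{s/2}\sum_{n=1}^{d}\binom{d}{n}\frac{1}{2^{d}}\,\frac{\Gamma(n/2+s/2)}{\Gamma(n/2)}$$ ($\Gamma$ is Euler's Gamma function). Then for every $k\ge 0$, $$\mathbb{E}\big[\|x^{(k)}\|^s\big]=\|x^{(0)}\|^s\big(\sigma^s I_0(s,d)\big)^k .$$ Let $\bar{\sigma}_0(s,d):=I_0(s,d)^{-1/s}$ and assume $x^{(0)}\neq 0$. Then: (i) if $\sigma=\bar{\sigma}_0(s,d)$, then $\mathbb{E}\|x^{(k)}\|^s=\|x^{(0)}\|^s$ for every $k\ge1$, while for every $p>s$, $\mathbb{E}\|x^{(k)}\|^p\to\infty$ exponentially fast in $k$; (ii) if $\sigma<\bar{\sigma}_0(s,d)$, then $\mathbb{E}\|x^{(k)}\|^s\to 0$ exponentially fast in $k$; (iii) if $\sigma>\bar{\sigma}_0(s,d)$, then $\mathbb{E}\|x^{(k)}\|^s\to\infty$ exponentially fast in $k$.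
   Context: Fix an integer width $d\ge1$ and a parameter $a\in[0,1]$. The parametric ReLU $\phi_a:\mathbb{R}\to\mathbb{R}$ is $\phi_a(z)=z$ for $z>0$ and $\phi_a(z)=az$ for $z\le 0$; it is applied componentwise to vectors ($\phi_0$ is ReLU, $\phi_1$ is the identity). Given $\sigma>0$ and a deterministic input $x^{(0)}\in\mathbb{R}^d$, the layer outputs of the fully connected network with zero biases are $x^{(k+1)}=\phi_a(W^{(k+1)}x^{(k)})$, $k\ge0$, where all entries of all matrices $W^{(1)},W^{(2)},\dots\in\mathbb{R}^{d\times d}$ are i.i.d. $\mathcal{N}(0,\sigma^2)$. $\|\cdot\|$ denotes the Euclidean norm. *)

(* Defs.v *)
From HB Require Import structures.
From mathcomp Require Import all_boot all_order all_algebra.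
From mathcomp Require Import all_classical all_reals all_analysis.
Set Implicit Arguments. Unset Strict Implicit. Unset Printing Implicit Defensive.
Import Order.TTheory GRing.Theory Num.Theory.
Local Open Scope classical_set_scope.
Local Open Scope ring_scope.

Definition Gamma {R : realType} (x : R) : R :=
  fine (\int[@lebesgue_measure R]_(t in `]0%R, +oo[) ((t `^ (x - 1)) * expR (- t))%:E)%E.

Definition prelu {R : realType} (a z : R) : R := if 0 < z then z else a * z.

Definition enorm {R : realType} (d : nat) (v : 'cV[R]_d) : R :=
  Num.sqrt (\sum_(i < d) (v i 0) ^+ 2).

Definition I0 {R : realType} (s : R) (d : nat) : R :=
  2 `^ (s / 2) * \sum_(1 <= n < d.+1)
     ('C(d, n)%:R / 2 ^+ d * (Gamma (n%:R / 2 + s / 2) / Gamma (n%:R / 2))).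

Definition sigma_bar0 {R : realType} (s : R) (d : nat) : R := I0 s d `^ (- s^-1).

Definition mutually_independent {dT : measure_display} {T : measurableType dT}
  {R : realType} (P : probability T R) (I : eqType) (X : I -> T -> R) : Prop :=
  forall (J : seq I) (B : I -> set R), uniq J ->
    (forall i, i \in J -> measurable (B i)) ->
    P (\bigcap_(i in [set` J]) (X i @^-1` B i)) =
    (\prod_(i <- J) P (X i @^-1` B i))%E.

(* The network: layer k+1 uses the random matrix (W k), i.e. W k = W^{(k+1)}. *)
Fixpoint layer {R : realType} {T : Type} (d : nat) (a : R)
  (W : nat -> 'I_d -> 'I_d -> T -> R) (x0 : 'cV[R]_d) (k : nat) (t : T)
  : 'cV[R]_d :=
  match k with
  | 0 => x0
  | k'.+1 => map_mx (prelu a) ((\matrix_(i, j) W k' i j t) *m layer a W x0 k' t)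
  end.

Definition moment {dT : measure_display} {T : measurableType dT} {R : realType}
  (P : probability T R) (d : nat) (a : R) (W : nat -> 'I_d -> 'I_d -> T -> R)
  (x0 : 'cV[R]_d) (p : R) (k : nat) : \bar R :=
  (\int[P]_t ((enorm (layer a W x0 k t)) `^ p)%:E)%E.

(* Main.v *)
Require Import Defs.
From HB Require Import structures.
From mathcomp Require Import all_boot all_order all_algebra.
From mathcomp Require Import all_classical all_reals all_analysis.
From mathcomp Require Import measurable_realfun ring lra.
Set Implicit Arguments. Unset Strict Implicit. Unset Printing Implicit Defensive.
Import Order.TTheory GRing.Theory Num.Theory.
Import numFieldNormedType.Exports.
Local Open Scope classical_set_scope.
Local Open Scope ring_scope.

(* Conditionally on the first k layers, W^(k+1) x^(k) is a centred Gaussian vector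
   with independent entries of variance (sigma |x^(k)|)^2, so E|x^(k)|^s is
   multiplied at each layer by sigma^s E|g^+|^s, where g is a standard Gaussian
   vector of dimension d.  Each squared rectified coordinate is 0 or g_i^2 with
   probability 1/2, whence a binomial mixture of chi moments.  For a sum Q of n
   halved squares, scaling gives E[Q^p e^(-lQ)] = (1+l)^(-n/2-p) E[Q^p];
   integrating against l^(p-1) dl and exchanging the integrals gives
   E[Q^p] = Gamma(n/2+p) / Gamma(n/2).  At the critical sigma, Z = sigma |g^+| has
   E Z^s = 1 and vanishes with probability 2^-d, so Young's inequality
   Z^s <= (s/p) Z^p + (1 - s/p) 1_{Z > 0} yields E Z^p > 1 for p > s. *)

(** The conditioning on a layer is expressed neither by conditional expectations nor by random
    vectors. Weights are integrated out one at a time: the integral of a function of the past and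
    one fresh weight splits over a product law, and the weights still to be integrated meanwhile
    count as past. All integrands are nonnegative with extended real values, so Tonelli's theorem
    applies before any moment is known to be finite; finiteness only appears with the Gamma values.
    What remains of a layer is one-dimensional: a walk on the squared norm that starts at 0 and adds
    one squared rectified coordinate per step. Its transition operator is half the identity plus
    half the operator of the unrectified square, and the binomial mixture is the binomial formula
    for the d-th power of that operator. The tilt by an exponential replaces the density of a sum of
    squares: only the one-dimensional Gaussian density and Gamma integrals over the half-line are
    ever computed. *)

(** * Image measures, densities and affine substitution *)

Section image_measure.
Context {d1 d2 : measure_display} {T1 : measurableType d1}
  {T2 : measurableType d2} {R : realType}.
Variables (m : {measure set T1 -> \bar R}) (f : T1 -> T2).
Hypothesis mf : measurable_fun setT f.

(* [pushforward] is a measure only up to a measurability proof that unification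
   cannot recover: this names the structure carrying that proof. *)
Definition image_measure : {measure set T2 -> \bar R} :=
  measure_function_pushforward__canonical__measure_function_Measure m mf.

Lemma image_measureE A : image_measure A = m (f @^-1` A).
Proof. by []. Qed.

Lemma ge0_integral_image (g : T2 -> \bar R) :
  measurable_fun setT g -> (forall y, (0 <= g y)%E) ->
  (\int[image_measure]_y g y = \int[m]_x g (f x))%E.
Proof. by move=> mg g0; rewrite (ge0_integral_pushforward mf). Qed.

End image_measure.

Section density.
Local Open Scope ereal_scope.
Context {dT : measure_display} {T : measurableType dT} {R : realType}.
Variables (mu nu : {measure set T -> \bar R}) (p : T -> R).
Hypotheses (mp : measurable_fun setT p) (p0 : forall x, (0 <= p x)%R).
Let mpE : measurable_fun setT (EFin \o p).
Proof. exact/measurable_EFinP. Qed.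

Hypothesis nuE : forall A, measurable A -> nu A = \int[mu]_(x in A) (p x)%:E.

Import HBNNSimple.

Let ge0_integral_density_nnsfun (h : {nnsfun T >-> R}) :
  \int[nu]_x (h x)%:E = \int[mu]_x ((h x)%:E * (p x)%:E).
Proof.
under eq_integral do rewrite fimfunE -fsumEFin//.
rewrite ge0_integral_fsum//; last 2 first.
  - by move=> r; exact/measurable_EFinP/measurableT_comp.
  - by move=> n x _; rewrite EFinM nnfun_muleindic_ge0.
under [RHS]eq_integral.
  move=> x _; rewrite fimfunE -fsumEFin// ge0_mule_fsuml; last first.
    by move=> r; rewrite EFinM nnfun_muleindic_ge0.
  over.
rewrite ge0_integral_fsum//; last 2 first.
  - move=> r; apply: emeasurable_funM => //; apply/measurable_EFinP.
    exact: measurableT_comp.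
  - by move=> n x _; rewrite mule_ge0 ?lee_fin// -lee_fin nnfun_muleindic_ge0.
apply: eq_fsbigr => r _.
rewrite integralZl_indic_nnsfun// integral_indic// setIT nuE//.
(* Pulling [r] out of the integral needs [r >= 0]; a negative [r] is not a value of [h], so its
   level set is empty. *)
have [r0|r0] := leP 0%R r; last first.
  rewrite preimage_nnfun0// integral_set0 mule0; apply/esym/integral0_eq => x _.
  by rewrite indicE in_set0 mulr0 mul0e.
rewrite integral_mkcond -ge0_integralZl_EFin//; last 2 first.
  - by move=> x _; rewrite /patch; case: ifP; rewrite ?lee_fin.
  - by apply/(measurable_restrictT _ _).1 => //; exact: measurable_funTS.
apply: eq_integral => x _; rewrite /patch indicE; case: ifP => _.
- by rewrite mulr1.
- by rewrite mule0 mulr0 mul0e.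
Qed.

Lemma ge0_integral_density (f : T -> \bar R) :
  measurable_fun setT f -> (forall x, 0 <= f x) ->
  \int[nu]_x f x = \int[mu]_x (f x * (p x)%:E).
Proof.
move=> mf f0; pose f_ := nnsfun_approx measurableT mf.
have cf x : (f_ n x)%:E @[n --> \oo] --> f x by exact: cvg_nnsfun_approx.
transitivity (limn (fun n => \int[nu]_x (f_ n x)%:E)).
  rewrite -monotone_convergence//=.
  - by apply: eq_integral => x _; apply/esym/cvg_lim.
  - by move=> n; exact: measurableT_comp.
  - by move=> n x _; rewrite lee_fin.
  - by move=> x _ a b ab; rewrite lee_fin//; exact/lefP/nd_nnsfun_approx.
transitivity (limn (fun n => \int[mu]_x ((f_ n x)%:E * (p x)%:E))).
  by apply/congr_lim/funext => n; exact: ge0_integral_density_nnsfun.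
rewrite -monotone_convergence//=.
- apply: eq_integral => x _; apply/cvg_lim => //.
  by apply: cvgeZr.
- by move=> n; apply: emeasurable_funM => //; exact: measurableT_comp.
- by move=> n x _; rewrite mule_ge0// lee_fin.
- by move=> x _ a b ab; rewrite lee_wpmul2r ?lee_fin//; exact/lefP/nd_nnsfun_approx.
Qed.

End density.

Section lebesgue_affine.
Context {R : realType}.
Local Notation mu := (@lebesgue_measure R).

Let aff (c m : R) : R -> measurableTypeR R := fun x => c * x + m.

Let measurable_aff c m : measurable_fun setT (aff c m).
Proof. by apply: measurable_funD => //; apply: measurable_funM. Qed.

Let ge0_integral_affine_gt0 (c m : R) (f : R -> \bar R) : 0 < c ->
  measurable_fun setT f -> (forall x, (0 <= f x)%E) ->
  (\int[mu]_x f x = c%:E * \int[mu]_x f (c * x + m)%R)%E.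
Proof.
move=> c0 mf f0.
pose c' := NngNum (ltW c0).
(* Lebesgue measure is [c] times its image under [x -> c x + m]: by uniqueness it suffices to
   compare both on half-open intervals. *)
transitivity (\int[mscale c' (image_measure mu (measurable_aff c m))]_x f x)%E.
  apply: eq_measure_integral => A mA _.
  apply: lebesgue_measure_unique => // _ [[a b]] _ <- /=.
  rewrite /mscale /= image_measureE.
  have -> : aff c m @^-1` `]a, b] = `](a - m) / c, (b - m) / c]%classic.
    apply/seteqP; split => x /=; rewrite !in_itv/=;
    by rewrite /aff ltr_pdivrMr// ler_pdivlMr// ltrBlDr lerBrDr (mulrC x).
  rewrite lebesgue_measure_itv/= lte_fin.
  have -> : mu `]((a - m) / c), ((b - m) / c)]%classic =
      if a < b then ((b - a) / c)%:E else 0%E.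
    rewrite lebesgue_measure_itv/= lte_fin ltr_pM2r ?invr_gt0// ltrD2r.
    by case: ifP => // _; rewrite -EFinB; congr EFin; ring.
  case: ifP => ab; last by rewrite mule0.
  by rewrite -EFinB -EFinM; congr EFin; field; exact: lt0r_neq0.
  exact: measurable_aff.
by rewrite ge0_integral_mscale// ge0_integral_image.
Qed.

Lemma ge0_integral_affine (c m : R) (f : R -> \bar R) : c != 0 ->
  measurable_fun setT f -> (forall x, (0 <= f x)%E) ->
  (\int[mu]_x f x = `|c|%:E * \int[mu]_x f (c * x + m)%R)%E.
Proof.
move=> c0 mf f0; have [cp|cn|/eqP] := ltgtP 0 c; last by rewrite eq_sym (negbTE c0).
  by rewrite gtr0_norm// -ge0_integral_affine_gt0.
rewrite ltr0_norm//.
(* Reflection invariance turns a negative slope [c] into the positive slope [- c]. *)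
transitivity (\int[mu]_x f (- x)%R)%E.
  have mN : measurable_fun setT (-%R : measurableTypeR R -> measurableTypeR R).
    exact: oppr_measurable.
  rewrite -(ge0_integral_image mu mN)//.
  by apply: eq_measure_integral => //= A mA _; exact/esym/lebesgue_measureN.
rewrite (@ge0_integral_affine_gt0 (- c) (- m))//; first last.
- by apply: measurableT_comp.
- by rewrite oppr_gt0.
by under eq_integral do rewrite mulNr -opprD opprK.
Qed.

End lebesgue_affine.

(** * Gaussian integrals *)

Section gaussian.
Context {R : realType}.
Local Notation mu := (@lebesgue_measure R).
Local Notation gauss := (normal_prob (0 : R) 1).
Implicit Types (m s a b : R) (h : R -> \bar R).

Lemma integral_gauss_cst (x : \bar R) : (\int[gauss]_ _ x = x)%E.
Proof.
rewrite integral_cst//= -[RHS]mule1; congr (_ * _)%E.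
exact: (@probability_setT _ _ _ gauss).
Qed.

Lemma normal_pdf_affine m s x : s != 0 ->
  `|s| * normal_pdf m s (s * x + m) = normal_pdf 0 1 x.
Proof.
move=> s0; rewrite !normal_pdfE ?oner_neq0// /normal_peak /normal_fun mulrA.
have s20 : s ^+ 2 != 0 by rewrite expf_neq0.
congr (_ * expR _).
  rewrite expr1n mul1r -mulrnAr sqrtrM ?sqr_ge0// sqrtr_sqr invfM mulrA.
  by rewrite divff ?mul1r// normr_eq0.
by rewrite addrK subr0; field.
Qed.

Lemma ge0_integral_normal m s h : measurable_fun setT h ->
  (forall x, (0 <= h x)%E) ->
  (\int[normal_prob m s]_x h x = \int[mu]_x (h x * (normal_pdf m s x)%:E))%E.
Proof.
move=> mh h0; apply: (@ge0_integral_density _ _ _ mu) => //.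
- exact: measurable_normal_pdf.
- exact: normal_pdf_ge0.
Qed.

Lemma ge0_integral_normal_affine m s h : s != 0 -> measurable_fun setT h ->
  (forall x, (0 <= h x)%E) ->
  (\int[normal_prob m s]_x h x = \int[gauss]_x h (s * x + m)%R)%E.
Proof.
move=> s0 mh h0.
have ma : measurable_fun setT (fun x : R => s * x + m).
  by apply: measurable_funD => //; apply: measurable_funM.
have mpdf m' s' : measurable_fun setT (fun x : R => (normal_pdf m' s' x)%:E).
  by apply/measurable_EFinP; exact: measurable_normal_pdf.
have pdf0 m' s' (x : R) : (0 <= (normal_pdf m' s' x)%:E)%E.
  by rewrite lee_fin normal_pdf_ge0.
rewrite (ge0_integral_normal m s mh h0).
have E := ge0_integral_normal 0 1 (measurableT_comp mh ma) (fun x => h0 _).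
rewrite [RHS]E.
rewrite (ge0_integral_affine m s0); first last.
- by move=> x; rewrite mule_ge0.
- exact: emeasurable_funM.
rewrite -ge0_integralZl_EFin//; first last.
- apply: emeasurable_funM; first exact: (measurableT_comp mh ma).
  exact: (measurableT_comp (mpdf m s) ma).
- by move=> x _; rewrite mule_ge0.
by apply: eq_integral => x _; rewrite muleCA -EFinM normal_pdf_affine.
Qed.

(** The density depends on the scale only through its square, so the scale -1 gives the standard law
    again, while the affine substitution with slope -1 reflects the argument. *)
Lemma ge0_integral_gaussN h : measurable_fun setT h ->
  (forall x, (0 <= h x)%E) ->
  (\int[gauss]_x h (- x)%R = \int[gauss]_x h x)%E.
Proof.
move=> mh h0; have N10 : (-1 : R) != 0 by rewrite oppr_eq0 oner_neq0.
transitivity (\int[normal_prob 0 (-1)]_x h x)%E.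
  rewrite [RHS](ge0_integral_normal_affine 0 N10 mh h0).
  by apply: eq_integral => x _; rewrite mulN1r addr0.
rewrite [LHS](ge0_integral_normal 0 (-1) mh h0).
rewrite [RHS](ge0_integral_normal 0 1 mh h0); apply: eq_integral => x _.
rewrite !normal_pdfE ?oppr_eq0 ?oner_neq0//.
by rewrite /normal_peak /normal_fun sqrrN.
Qed.

Let ge0_integral_gauss_norm a h : measurable_fun setT h ->
  (forall x, (0 <= h x)%E) ->
  (\int[gauss]_x h (a * x)%R = \int[gauss]_x h (`|a| * x)%R)%E.
Proof.
move=> mh h0; have [a0|a0] := leP 0 a; first by rewrite ger0_norm.
have ma : measurable_fun setT (fun x : R => h (a * x)).
  by apply: (measurableT_comp mh); apply: measurable_funM.
rewrite ltr0_norm// -[LHS](ge0_integral_gaussN ma (fun x => h0 _)).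
by under eq_integral do rewrite mulrN -mulNr.
Qed.

(* Completing the square: both sides are the joint density of [g] and
   [a * g + b * g'] for independent standard Gaussians [g] and [g']. *)
Lemma normal_pdf_swap a b u g : b != 0 ->
  normal_pdf (a * g) b u * normal_pdf 0 1 g =
  normal_pdf 0 (Num.sqrt (a ^+ 2 + b ^+ 2)) u *
  normal_pdf (a * u / (a ^+ 2 + b ^+ 2)) (b / Num.sqrt (a ^+ 2 + b ^+ 2)) g.
Proof.
move=> b0.
have c2gt0 : 0 < a ^+ 2 + b ^+ 2.
  by rewrite ltr_wpDl ?sqr_ge0// exprn_even_gt0.
have cgt0 : 0 < Num.sqrt (a ^+ 2 + b ^+ 2) by rewrite sqrtr_gt0.
have cE : Num.sqrt (a ^+ 2 + b ^+ 2) ^+ 2 = a ^+ 2 + b ^+ 2.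
  by rewrite sqr_sqrtr// ltW.
have c0 : Num.sqrt (a ^+ 2 + b ^+ 2) != 0 by rewrite gt_eqF.
have bc0 : b / Num.sqrt (a ^+ 2 + b ^+ 2) != 0 by rewrite mulf_neq0 ?invr_eq0.
rewrite !normal_pdfE ?oner_neq0//.
rewrite /normal_peak /normal_fun expr_div_n cE mulrACA -expRD [RHS]mulrACA -expRD.
have b20 : b ^+ 2 != 0 by rewrite expf_neq0.
congr (_ * expR _); last first.
  by rewrite !subr0 expr1n; field; rewrite (gt_eqF c2gt0).
rewrite -!invfM; congr (_^-1).
have sqrtM2 (y z : R) : 0 <= y -> Num.sqrt (y * pi *+ 2) * Num.sqrt z =
    Num.sqrt (y * pi *+ 2 * z).
  by move=> y0; rewrite sqrtrM// mulrn_wge0// mulr_ge0 ?pi_ge0.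
rewrite !sqrtM2 ?sqr_ge0 ?(ltW c2gt0)//.
by congr Num.sqrt; rewrite expr1n; field; rewrite gt_eqF.
Qed.

(** With [u = a g + b y], [normal_pdf_swap] factors the joint density of [g] and [u] into the
    marginal of [u] and the conditional density of [g]. After Tonelli the latter integrates to 1. *)
Lemma ge0_integral_gauss_conv a b h : measurable_fun setT h ->
  (forall x, (0 <= h x)%E) ->
  (\int[gauss]_g \int[gauss]_y h (a * g + b * y)%R =
   \int[gauss]_z h (Num.sqrt (a ^+ 2 + b ^+ 2) * z)%R)%E.
Proof.
(* For [b = 0] the law of [a g + b y] given [g] is a point mass without density. The right-hand side
   then has scale |a|, which symmetry identifies with [a]. *)
move=> mh h0; have [->|b0] := eqVneq b 0.
  under eq_integral => g _.
    under eq_integral do rewrite mul0r addr0.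
    rewrite integral_gauss_cst; over.
  by rewrite expr0n addr0 sqrtr_sqr ge0_integral_gauss_norm.
set c := Num.sqrt _.
have c0 : c != 0.
  by rewrite gt_eqF// sqrtr_gt0 ltr_wpDl ?sqr_ge0// exprn_even_gt0.
have mpdf m s : measurable_fun setT (fun x : R => (normal_pdf m s x)%:E).
  by apply/measurable_EFinP; exact: measurable_normal_pdf.
have pdf0 m s (x : R) : (0 <= (normal_pdf m s x)%:E)%E.
  by rewrite lee_fin normal_pdf_ge0.
transitivity (\int[gauss]_g \int[mu]_u (h u * (normal_pdf (a * g) b u)%:E))%E.
  apply: eq_integral => g _; rewrite -[RHS](ge0_integral_normal (a * g) b mh h0).
  rewrite [RHS](ge0_integral_normal_affine (a * g) b0 mh h0).
  by apply: eq_integral => y _; rewrite addrC.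
have mF : measurable_fun setT
    (fun z : R * R => (h z.2 * (normal_pdf (a * z.1) b z.2)%:E)%E).
  apply: emeasurable_funM; first exact: measurableT_comp.
  apply/measurable_EFinP.
  under eq_fun do rewrite normal_pdfE// /normal_fun.
  apply: measurable_funM => //; apply: measurableT_comp => //.
  apply: measurable_funM => //; apply: measurableT_comp => //.
  apply: measurable_funX; apply: measurable_funB => //.
  exact: measurable_funM.
have mG : measurable_fun setT (fun z : R * R =>
    (h z.2 * (normal_pdf (a * z.1) b z.2)%:E * (normal_pdf 0 1 z.1)%:E)%E).
  by apply: emeasurable_funM => //; apply: (measurableT_comp (mpdf 0 1)).
have F0 z : (0 <= h z.2 * (normal_pdf (a * z.1) b z.2)%:E)%E by rewrite mule_ge0.
have mI := @measurable_fun_fubini_tonelli_F _ _ _ _ _ mu _ mF F0.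
have I0 g : (0 <= fubini_F mu
    (fun z : R * R => h z.2 * (normal_pdf (a * z.1) b z.2)%:E) g)%E.
  by apply: integral_ge0 => u _; exact: (F0 (g, u)).
rewrite [LHS](ge0_integral_normal 0 1 mI I0).
transitivity (\int[mu]_g \int[mu]_u
    (h u * (normal_pdf (a * g) b u)%:E * (normal_pdf 0 1 g)%:E))%E.
  apply: eq_integral => g _; rewrite ge0_integralZr//.
  - exact: (emeasurable_funM mh (mpdf _ _)).
  - by move=> u _; rewrite mule_ge0.
rewrite (@fubini_tonelli _ _ _ _ _ mu mu _ mG); last first.
  by move=> z; rewrite !mule_ge0.
transitivity (\int[mu]_u (h u * (normal_pdf 0 c u)%:E))%E.
  apply: eq_integral => u _ /=.
  under eq_integral do rewrite -muleA -EFinM normal_pdf_swap// EFinM muleA.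
  rewrite ge0_integralZl ?mule_ge0//; last exact: mpdf.
  by rewrite integral_normal_pdf mule1.
rewrite -[LHS](ge0_integral_normal 0 c mh h0).
rewrite [LHS](ge0_integral_normal_affine 0 c0 mh h0).
by apply: eq_integral => z _; rewrite addr0.
Qed.

(** The tilted standard density has exponent -(1 + l) g^2 / 2: it is a centred Gaussian density of
    variance 1 / (1 + l), up to the ratio of the normalizing constants. *)
Lemma ge0_integral_gauss_tilt l h : 0 <= l -> measurable_fun setT h ->
  (forall x, (0 <= h x)%E) ->
  (\int[gauss]_g (h g * (expR (- (l * (g ^+ 2 / 2))))%:E) =
   ((Num.sqrt (1 + l))^-1)%:E * \int[gauss]_g h ((Num.sqrt (1 + l))^-1 * g)%R)%E.
Proof.
move=> l0 mh h0; set c := (Num.sqrt _)^-1.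
have cgt0 : 0 < c by rewrite invr_gt0 sqrtr_gt0 ltr_wpDr.
have c0 : c != 0 by rewrite gt_eqF.
have mexp : measurable_fun setT (fun g : R => (expR (- (l * (g ^+ 2 / 2))))%:E).
  apply/measurable_EFinP/measurableT_comp => //.
  apply: measurableT_comp => //; apply: measurable_funM => //.
  by apply: measurable_funM => //; exact: measurable_funX.
have mhexp := emeasurable_funM mh mexp.
have hexp0 g : (0 <= h g * (expR (- (l * (g ^+ 2 / 2))))%:E)%E.
  by rewrite mule_ge0// lee_fin expR_ge0.
rewrite [LHS](ge0_integral_normal 0 1 mhexp hexp0).
have -> : (\int[gauss]_g h (c * g)%R = \int[mu]_x (h x * (normal_pdf 0 c x)%:E))%E.
  rewrite -[RHS](ge0_integral_normal 0 c mh h0).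
  rewrite [RHS](ge0_integral_normal_affine 0 c0 mh h0).
  by apply: eq_integral => g _; rewrite addr0.
rewrite -ge0_integralZl_EFin//; first last.
- exact: ltW.
- apply: emeasurable_funM => //; by apply/measurable_EFinP; exact: measurable_normal_pdf.
- by move=> x _; rewrite mule_ge0// lee_fin normal_pdf_ge0.
apply: eq_integral => x _; rewrite -muleA [RHS]muleCA; congr (_ * _)%E.
rewrite -!EFinM; congr EFin; rewrite !normal_pdfE ?oner_neq0//.
rewrite /normal_peak /normal_fun [LHS]mulrCA -expRD [RHS]mulrA; congr (_ * expR _).
  rewrite expr1n mul1r -mulrnAr sqrtrM ?sqr_ge0// sqrtr_sqr invfM mulrA.
  by rewrite gtr0_norm// divff// mul1r.
have lE : c ^+ 2 = (1 + l)^-1 by rewrite exprVn sqr_sqrtr// addr_ge0.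
rewrite lE expr1n subr0; field.
by rewrite gt_eqF// ltr_wpDr.
Qed.

Lemma measurable_relu : measurable_fun setT (@prelu R 0).
Proof.
rewrite (_ : prelu 0 = (fun z => Num.max z 0)); last first.
  by apply/funext => z; rewrite /prelu mul0r maxEle leNgt; case: ltP.
exact: measurable_maxr.
Qed.

(* Averaging over the sign of [g] needs no null set: one of the two
   rectified values is [`|g|], the other is [0]. *)
Lemma ge0_integral_gauss_relu h : measurable_fun setT h ->
  (forall x, (0 <= h x)%E) ->
  (\int[gauss]_g h (prelu 0 g ^+ 2)%R =
   (2^-1)%:E * (h 0%R + \int[gauss]_g h (g ^+ 2)%R))%E.
Proof.
move=> mh h0.
have mrelu := measurable_relu.
have mX : measurable_fun setT (fun g : R => h (g ^+ 2)).
  by apply: (measurableT_comp mh); exact: measurable_funX.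
have mY : measurable_fun setT (fun g => h (prelu 0 g ^+ 2)).
  by apply: (measurableT_comp mh); exact: measurable_funX.
have mYN : measurable_fun setT (fun g : R => h (prelu 0 (- g) ^+ 2)).
  by apply: (measurableT_comp mY).
set I := (\int[gauss]_g h (prelu 0 g ^+ 2)%R)%E.
have -> : (h 0%R + \int[gauss]_g h (g ^+ 2)%R = I + I)%E.
  have IN : I = (\int[gauss]_g h (prelu 0 (- g) ^+ 2)%R)%E.
    by rewrite [RHS](ge0_integral_gaussN mY (fun x => h0 _)).
  rewrite [X in (I + X)%E]IN -ge0_integralD//.
  transitivity (\int[gauss]_g (h 0%R + h (g ^+ 2)%R))%E.
    by rewrite ge0_integralD// integral_gauss_cst.
  apply: eq_integral => g _; rewrite /prelu oppr_gt0 !mul0r.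
  have [g0|g0|<-] /= := ltgtP 0 g; rewrite expr0n/=.
  - by rewrite addeC.
  - by rewrite sqrrN.
  - by [].
have I0 : (0 <= I)%E by apply: integral_ge0.
have -> : (I + I = 2%:E * I)%E.
  by rewrite -[X in (X + X)%E]mul1e -ge0_muleDl// -EFinD.
by rewrite muleA -EFinM mulVf// mul1e.
Qed.

End gaussian.

(** * Independence of a weight from the past *)

Section independent_past.
Context {dT : measure_display} {T : measurableType dT} {R : realType}.
Variables (P : probability T R) (I : choiceType) (X : I -> {RV P >-> R}).
Hypothesis indX : mutually_independent P (fun i => X i : T -> R).
Implicit Types D : set I.

(** Finite-dimensional events form a pi-system on which [mutually_independent] speaks directly;
    measures agreeing on them agree on the generated sigma-algebra. *)
Definition cylinders D : set (set T) := [set A | exists J (B : I -> set R),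
  [/\ uniq J, forall i, i \in J -> D i, forall i, measurable (B i) &
      A = \bigcap_(i in [set` J]) X i @^-1` B i]].

(* [T] with the sigma-algebra generated by the [X i], [i] in [D] *)
Definition past D := g_sigma_algebraType (cylinders D).

Lemma setI_closed_cylinders D : setI_closed (cylinders D).
Proof.
move=> _ _ [J [B [uJ JD mB ->]]] [J' [B' [uJ' J'D mB' ->]]].
exists (undup (J ++ J')), (fun i => (if i \in J then B i else setT) `&`
                                    (if i \in J' then B' i else setT)).
split.
- exact: undup_uniq.
- by move=> i; rewrite mem_undup mem_cat => /orP[/JD|/J'D].
- by move=> i; apply: measurableI; case: ifP.
- apply/seteqP; split => t /=.
    by move=> [BJ BJ'] i /= _; split; case: ifP => // iJ; [exact: BJ|exact: BJ'].
  move=> H; split => i /= iJ.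
  + by have := H i; rewrite /= mem_undup mem_cat iJ => /(_ isT)[].
  + by have := H i; rewrite /= mem_undup mem_cat iJ orbT => /(_ isT)[].
Qed.

Lemma cylinders_measurable D : cylinders D `<=` measurable.
Proof.
move=> _ [J [B [_ _ mB ->]]].
rewrite bigcap_seq; apply: bigsetI_measurable => i _.
by rewrite -[_ @^-1` _]setTI; exact: measurable_funP.
Qed.

Lemma sub_cylinders D D' : D `<=` D' -> cylinders D `<=` cylinders D'.
Proof.
move=> DD' _ [J [B [uJ JD mB ->]]]; exists J, B; split => //.
by move=> i /JD /DD'.
Qed.

Lemma cylindersT D : cylinders D setT.
Proof.
exists [::], (fun=> setT); split => //.
by apply/seteqP; split => // t _ i.
Qed.

Lemma past_measurable D (A : set T) :
  measurable (A : set (past D)) -> measurable A.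
Proof.
move=> mA; apply: (@smallest_sub _ (sigma_algebra setT) (cylinders D)) => //.
- exact: sigma_algebra_measurable.
- exact: cylinders_measurable.
Qed.

Lemma measurable_past_id D : measurable_fun setT (id : T -> past D).
Proof. by move=> _ A mA; rewrite setTI preimage_id; exact: past_measurable mA. Qed.

Lemma measurable_past_sub D D' : D `<=` D' ->
  measurable_fun setT (id : past D' -> past D).
Proof.
move=> DD' _ A mA; rewrite setTI preimage_id.
exact: (sub_smallest2r _ (sub_cylinders DD') mA).
Qed.

Lemma measurable_past D i : D i -> measurable_fun setT (X i : past D -> R).
Proof.
move=> Di _ B mB; rewrite setTI; apply: sub_sigma_algebra.
exists [:: i], (fun=> B); split => //.
- by move=> j; rewrite inE => /eqP ->.
- apply/seteqP; split => t /=; first by move=> Bt j /=; rewrite inE => /eqP ->.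
  by move=> /(_ i); apply; rewrite /= inE.
Qed.

(** For fixed [B] both sides are finite measures in [A]: a restriction of [P] and a multiple of [P].
    On a cylinder over [J] they agree by independence of the family [i :: J], where [i] is not in
    [J] because it lies outside [D]; the pi-lambda theorem extends this to the whole past. *)
Lemma past_indep D i (A : set T) (B : set R) : ~ D i ->
  measurable (A : set (past D)) -> measurable B ->
  (P (A `&` X i @^-1` B) = P A * P (X i @^-1` B))%E.
Proof.
move=> Di mA mB.
have mC : measurable (X i @^-1` B).
  by rewrite -[_ @^-1` _]setTI; exact: measurable_funP.
have c0 : 0 <= fine (P (X i @^-1` B)) by rewrite fine_ge0// measure_ge0.
have cE : (fine (P (X i @^-1` B)))%:E = P (X i @^-1` B).
  by rewrite fineK// fin_num_measure.
pose c := NngNum c0.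
have -> : (P A * P (X i @^-1` B) = mscale c P A)%E.
  by rewrite /mscale/= cE muleC.
have -> : (P (A `&` X i @^-1` B) = mrestr P mC A)%E by [].
apply: (@g_sigma_algebra_measure_unique _ R T (cylinders D) _ (fun=> setT) _ _
  (mrestr P mC) (mscale c P)) => //.
- exact: cylinders_measurable.
- by move=> _; exact: cylindersT.
- by rewrite bigcup_const.
- exact: setI_closed_cylinders.
- move=> _ [J [C [uJ JD mB' ->]]].
  have iJ : i \notin J by apply/negP => /JD.
  pose C' j := if j == i then B else C j.
  have C'E j : j \in J -> C' j = C j.
    by move=> jJ; rewrite /C' ifN//; apply: contraNneq iJ => <-.
  have := @indX (i :: J) C'; rewrite /= iJ uJ => /(_ isT) H.
  rewrite /mrestr /mscale /= cE.
  transitivity (P (\bigcap_(j in [set` (i :: J)]) X j @^-1` C' j)).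
    congr (P _); apply/seteqP; split => t /=.
      move=> [JC iB] j /=; rewrite inE => /orP[/eqP ->|jJ].
        by rewrite /C' eqxx.
      by rewrite C'E//; exact: JC.
    move=> H'; split.
      by move=> j /= jJ; rewrite -C'E//; apply: H'; rewrite /= inE jJ orbT.
    by have := H' i; rewrite /= inE eqxx /C' eqxx => /(_ isT).
  rewrite H; last by move=> j _; rewrite /C'; case: ifP.
  rewrite big_cons {1}/C' eqxx; congr (_ * _)%E.
  rewrite (@indX J C)//.
  by rewrite big_seq [RHS]big_seq; apply: eq_bigr => j jJ; rewrite C'E.
- by move=> _; rewrite -ge0_fin_numE ?measure_ge0// fin_num_measure.
Qed.

(** This stands in for conditional expectation. The sample point itself serves as the state of the
    past, and only the coarser sigma-algebra of [past D] hides the other weights. The joint law of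
    past and weight is a product because it is one on rectangles. *)
Lemma ge0_integral_past_indep D i (F : past D * R -> \bar R) : ~ D i ->
  measurable_fun setT F -> (forall z, (0 <= F z)%E) ->
  (\int[P]_t F (t, X i t) = \int[P]_t \int[distribution P (X i)]_y F (t, y))%E.
Proof.
move=> Di mF F0.
(* The law of the identity into [past D] is the restriction of [P] to the sigma-algebra of the
   past. *)
pose idm : {mfun T >-> past D} := HB.pack (id : T -> past D)
  (isMeasurableFun.Build _ _ _ _ _ (@measurable_past_id D)).
pose m1 : probability (past D) R := distribution P idm.
pose m2 : probability R R := distribution P (X i).
have mpsi : measurable_fun setT (fun t : T => (t : past D, X i t)).
  apply/prod_measurable_funP; split; first exact: measurable_past_id.
  exact: measurable_funP.
rewrite -(ge0_integral_image P mpsi mF F0).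
transitivity (\int[(m1 \x m2)%E]_z F z)%E.
  apply: eq_measure_integral => A mA _; apply/esym.
  apply: product_measure_unique => // B C mB mC.
  by rewrite image_measureE; exact: (past_indep Di mB mC).
rewrite fubini_tonelli1//.
rewrite (ge0_integral_pushforward (@measurable_past_id D))//=.
- exact: measurable_fun_fubini_tonelli_F.
- by move=> t _; apply: integral_ge0 => y _.
Qed.

End independent_past.

Lemma measurable_sum_seq (dS : measure_display) (S : measurableType dS)
    (R : realType) (K : eqType) (js : seq K) (g : K -> S -> R) :
  (forall j, j \in js -> measurable_fun setT (g j)) ->
  measurable_fun setT (fun t => \sum_(j <- js) g j t).
Proof.
elim: js => [|j js IH] mg.
  under eq_fun do rewrite big_nil; exact: measurable_cst.
under eq_fun do rewrite big_cons.
apply: measurable_funD; first exact: (mg j (mem_head _ _)).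
by apply: IH => l ljs; apply: mg; rewrite inE ljs orbT.
Qed.

Lemma measurable_sqrt (R : realType) : measurable_fun setT (@Num.sqrt R).
Proof. by apply: continuous_measurable_fun; exact: sqrt_continuous. Qed.

(** * Integrating out a fresh Gaussian matrix *)

Section fresh_gaussian_matrix.
Context {dT : measure_display} {T : measurableType dT} {R : realType}.
Variables (P : probability T R) (I : choiceType) (X : I -> {RV P >-> R}).
Hypothesis indX : mutually_independent P (fun i => X i : T -> R).
Variable sigma : R.
Hypothesis sigma0 : 0 < sigma.
Hypothesis lawX : forall i B, measurable B ->
  distribution P (X i) B = normal_prob 0 sigma B.
Local Notation gauss := (normal_prob (0 : R) 1).
Local Notation past := (past X).
Implicit Types D : set I.

Lemma ge0_integral_past_gauss D i (F : past D * R -> \bar R) : ~ D i ->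
  measurable_fun setT F -> (forall z, (0 <= F z)%E) ->
  (\int[P]_t F (t, X i t) = \int[P]_t \int[gauss]_y F (t, sigma * y)%R)%E.
Proof.
move=> Di mF F0; rewrite (ge0_integral_past_indep indX Di mF F0).
apply: eq_integral => t _.
have mFt : measurable_fun setT (fun y => F (t, y)).
  by apply: (measurableT_comp mF); exact: measurable_fun_pair.
have mXi : measurable_fun setT (X i : T -> measurableTypeR R).
  by move=> mT B mB; exact: (measurable_funP (X i) mT).
transitivity (\int[normal_prob 0 sigma]_y F (t, y))%E.
  rewrite [LHS]ge0_integral_distribution//.
  rewrite -[LHS](ge0_integral_image P mXi mFt (fun y => F0 _)).
  by apply: eq_measure_integral => A mA _; exact: lawX.
rewrite (ge0_integral_normal_affine 0 (lt0r_neq0 sigma0) mFt (fun y => F0 _)).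
by apply: eq_integral => y _; rewrite addr0.
Qed.

Lemma measurable_fun_gauss_int (dS : measure_display) (S : measurableType dS)
    (F : S * R -> \bar R) : measurable_fun setT F -> (forall z, (0 <= F z)%E) ->
  measurable_fun setT (fun s => \int[gauss]_y F (s, y))%E.
Proof.
move=> mF F0.
exact: (@measurable_fun_fubini_tonelli_F _ _ _ _ _ gauss _ mF F0).
Qed.

(** The head weight is integrated first, which turns [h] into a new function [h'] of the past and of
    the remaining sum; the induction hypothesis replaces that sum by one Gaussian, and the
    convolution identity merges the two. Keeping [h] arbitrary is what lets the induction pass to
    [h']. *)
Lemma ge0_integral_fresh_row D (K : eqType) (f : K -> I) (js : seq K)
    (x : K -> past D -> R) (h : past D * R -> \bar R) :
  injective f -> uniq js -> (forall j, j \in js -> ~ D (f j)) ->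
  (forall j, measurable_fun setT (x j)) ->
  measurable_fun setT h -> (forall z, (0 <= h z)%E) ->
  (\int[P]_t h (t, \sum_(j <- js) X (f j) t * x j t)%R =
   \int[P]_t \int[gauss]_z
     h (t, sigma * Num.sqrt (\sum_(j <- js) x j t ^+ 2) * z)%R)%E.
Proof.
move=> injf; elim: js h => [|j js IH] h /=.
  move=> _ _ _ mh h0; apply: eq_integral => t _.
  under [in RHS]eq_integral do rewrite big_nil sqrtr0 mulr0 mul0r.
  by rewrite big_nil integral_gauss_cst.
move=> /andP[jjs ujs] Djs mx mh h0.
(* The other weights of the row join the past, so that their sum [S] is measurable there and the
   head weight is still fresh. *)
pose D' : set I := D `|` [set f l | l in [set` js]].
have DD' : D `<=` D' by move=> i; left.
have mid : measurable_fun setT (id : past D' -> past D).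
  exact: measurable_past_sub DD'.
have mx' l : measurable_fun setT (x l : past D' -> R).
  exact: (measurableT_comp (mx l) mid).
pose S (t : past D') := \sum_(l <- js) X (f l) t * x l t.
have mS : measurable_fun setT S.
  apply: measurable_sum_seq => l ljs; apply: measurable_funM => //.
  by apply: measurable_past; right; exists l.
pose F (z : past D' * R) := h (z.1, z.2 * x j z.1 + S z.1).
have mF : measurable_fun setT F.
  apply: (measurableT_comp mh); apply: measurable_fun_pair.
    exact: (measurableT_comp mid measurable_fst).
  apply: measurable_funD; last exact: measurableT_comp.
  by apply: measurable_funM => //; exact: measurableT_comp.
have D'j : ~ D' (f j).
  move=> [|[l /= ljs /injf lj]]; first by apply: Djs; rewrite inE eqxx.
  by rewrite -lj ljs in jjs.
under eq_integral do rewrite big_cons.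
rewrite (ge0_integral_past_gauss D'j mF (fun z => h0 _)).
pose h1 (w : past D * R * R) := h (w.1.1, sigma * w.2 * x j w.1.1 + w.1.2).
have mh1 : measurable_fun setT h1.
  apply: (measurableT_comp mh); apply: measurable_fun_pair.
    exact: measurableT_comp.
  apply: measurable_funD; last exact: measurableT_comp.
  apply: measurable_funM; first exact: measurable_funM.
  by apply: (measurableT_comp (mx j)); exact: measurableT_comp.
pose h' (z : past D * R) := (\int[gauss]_y h1 (z, y))%E.
have mh' : measurable_fun setT h'.
  exact: (measurable_fun_gauss_int mh1 (fun w => h0 _)).
have h'0 z : (0 <= h' z)%E by apply: integral_ge0 => y _; exact: h0.
rewrite (IH h')//; last by move=> l ljs; apply: Djs; rewrite inE ljs orbT.
apply: eq_integral => t _.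
have mht : measurable_fun setT (fun u => h (t, u)).
  by apply: (measurableT_comp mh); exact: measurable_fun_pair.
have := ge0_integral_gauss_conv (sigma * Num.sqrt (\sum_(l <- js) x l t ^+ 2))
  (sigma * x j t) mht (fun u => h0 _).
rewrite -[X in X = _ -> _]/(\int[gauss]_g _)%E => E.
transitivity (\int[gauss]_g \int[gauss]_y h (t, sigma *
  Num.sqrt (\sum_(l <- js) x l t ^+ 2) * g + sigma * x j t * y)%R)%E.
  apply: eq_integral => g _; apply: eq_integral => y _.
  by rewrite /h1/=; congr (h (_, _)); ring.
rewrite E; apply: eq_integral => z _; congr (h (_, _ * _)).
have Q0 : 0 <= \sum_(l <- js) x l t ^+ 2 by apply: sumr_ge0 => l _; exact: sqr_ge0.
rewrite !exprMn sqr_sqrtr// -mulrDr sqrtrM ?sqr_ge0// sqrtr_sqr gtr0_norm//.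
by rewrite big_cons addrC.
Qed.

(** Transition operator of the walk that accumulates the squared norm: one step adds the square of a
    rectified centred Gaussian of standard deviation |r|. *)
Definition relu_smooth (r : R) (f : R -> \bar R) (q : R) : \bar R :=
  (\int[gauss]_z f (q + prelu 0 (r * z) ^+ 2)%R)%E.

(** Every row meets the same input [x], so given the past each one contributes the same operator.
    The head row is integrated with the other rows counted as past, and it is the operator applied
    directly to [h]. *)
Lemma ge0_integral_fresh_matrix D (K L : eqType) (f : L * K -> I)
    (js : seq K) (ls : seq L) (x : K -> past D -> R) (h : past D * R -> \bar R) :
  injective f -> uniq js -> uniq ls ->
  (forall l j, l \in ls -> j \in js -> ~ D (f (l, j))) ->
  (forall j, measurable_fun setT (x j)) ->
  measurable_fun setT h -> (forall z, (0 <= h z)%E) ->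
  (\int[P]_t h (t, \sum_(l <- ls)
      prelu 0 (\sum_(j <- js) X (f (l, j)) t * x j t) ^+ 2)%R =
   \int[P]_t iter (size ls)
     (relu_smooth (sigma * Num.sqrt (\sum_(j <- js) x j t ^+ 2)))
     (fun q => h (t, q)) 0%R)%E.
Proof.
move=> injf ujs; elim: ls h => [|l ls IH] h.
  move=> _ _ _ mh h0; apply: eq_integral => t _.
  by rewrite big_nil.
move=> /andP[lls uls] Dls mx mh h0.
pose D' : set I := D `|` [set f z | z in [set z | z.1 \in ls /\ z.2 \in js]].
have DD' : D `<=` D' by move=> i; left.
have mid : measurable_fun setT (id : past D' -> past D).
  exact: measurable_past_sub DD'.
have mx' j : measurable_fun setT (x j : past D' -> R).
  exact: (measurableT_comp (mx j) mid).
pose S (t : past D') :=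
  \sum_(l <- ls) prelu 0 (\sum_(j <- js) X (f (l, j)) t * x j t) ^+ 2.
have mS : measurable_fun setT S.
  apply: measurable_sum_seq => i ils; apply: measurable_funX.
  apply: (measurableT_comp measurable_relu).
  apply: measurable_sum_seq => j jjs; apply: measurable_funM => //.
  by apply: measurable_past; right; exists (i, j).
pose h1 (z : past D' * R) := h (z.1, S z.1 + prelu 0 z.2 ^+ 2).
have mh1 : measurable_fun setT h1.
  apply: (measurableT_comp mh); apply: measurable_fun_pair.
    exact: (measurableT_comp mid measurable_fst).
  apply: measurable_funD; first exact: measurableT_comp.
  apply: measurable_funX; apply: (measurableT_comp measurable_relu).
  exact: measurable_snd.
have injl : injective (fun j => f (l, j)) by move=> j j' /injf[].
have D'l j : j \in js -> ~ D' (f (l, j)).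
  move=> jjs [|[[i j'] /= [ils j'js] /injf[il _]]].
    by apply: Dls => //; rewrite inE eqxx.
  by rewrite -il ils in lls.
have := ge0_integral_fresh_row injl ujs D'l mx' mh1 (fun z => h0 _).
rewrite /h1/= => E.
under eq_integral do rewrite big_cons addrC.
rewrite E.
pose r (t : past D) := sigma * Num.sqrt (\sum_(j <- js) x j t ^+ 2).
have mr : measurable_fun setT r.
  apply: measurable_funM => //; apply: (measurableT_comp (@measurable_sqrt R)).
  by apply: measurable_sum_seq => j _; exact: measurable_funX.
pose h2 (w : past D * R * R) := h (w.1.1, w.1.2 + prelu 0 (r w.1.1 * w.2) ^+ 2).
have mh2 : measurable_fun setT h2.
  apply: (measurableT_comp mh); apply: measurable_fun_pair.
    exact: measurableT_comp.
  apply: measurable_funD; first exact: measurableT_comp.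
  apply: measurable_funX; apply: (measurableT_comp measurable_relu).
  apply: measurable_funM => //.
  by apply: (measurableT_comp mr); exact: measurableT_comp.
pose h' (z : past D * R) := (\int[gauss]_y h2 (z, y))%E.
have mh' : measurable_fun setT h'.
  exact: (measurable_fun_gauss_int mh2 (fun w => h0 _)).
have h'0 z : (0 <= h' z)%E by apply: integral_ge0 => y _; exact: h0.
have := IH h' uls _ mx mh' h'0; rewrite /h'/h2/= => ->.
  by apply: eq_integral => t _; rewrite -iterS iterSr.
by move=> i j ils jjs; apply: Dls => //; rewrite inE ils orbT.
Qed.

End fresh_gaussian_matrix.

(** * The Gamma function *)

Section gamma_function.
Context {R : realType}.
Local Notation mu := (@lebesgue_measure R).
Implicit Types x c t : R.

Lemma measurable_Gamma_kernel x c (D : set R) :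
  measurable_fun D (fun t : R => (t `^ (x - 1) * expR (- (c * t)))%:E).
Proof.
apply: measurable_funTS; apply/measurable_EFinP; apply: measurable_funM => //.
by apply: measurableT_comp => //; exact: measurableT_comp.
Qed.

Lemma Gamma_kernel_ge0 x c t : (0 <= (t `^ (x - 1) * expR (- (c * t)))%:E)%E.
Proof. by rewrite lee_fin mulr_ge0 ?powR_ge0 ?expR_ge0. Qed.

Let measurable_powRE x (D : set R) :
  measurable_fun D (fun t : R => (t `^ x)%:E).
Proof.
apply: measurable_funTS; apply/measurable_EFinP; exact: measurable_powR.
Qed.

Let integral_powR_cc x (e : R) : 0 < x -> 0 < e < 1 ->
  (\int[mu]_(t in `[e, 1%R]) (t `^ (x - 1))%:E <= (x^-1)%:E)%E.
Proof.
move=> x0 /andP[e0 e1].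
have dF (t : R) : 0 < t -> is_derive t 1 (fun t => t `^ x * x^-1) (t `^ (x - 1)).
  move=> t0; have H := is_derive1_powR x t0.
  apply: is_derive_eq.
  by rewrite scaler0 add0r /GRing.scale/= mulrA mulVf ?mul1r// gt_eqF.
have cF (r t : R) : 0 < t -> {for t, continuous (fun t : R => t `^ r)}.
  move=> t0; apply: differentiable_continuous; apply/derivable1_diffP.
  by apply: derivable_powR; rewrite in_itv/= t0.
rewrite (@continuous_FTC2 _ _ (fun t => t `^ x * x^-1))//.
- rewrite powR1 mul1r -EFinB lee_fin lerBlDr lerDl.
  by rewrite mulr_ge0 ?powR_ge0// invr_ge0 ltW.
- apply: continuous_in_subspaceT => t /[!inE]/=; rewrite in_itv/= => /andP[et _].
  by apply: cF; exact: lt_le_trans et.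
- have cG (t : R) : 0 < t -> {for t, continuous (fun t : R => t `^ x * x^-1)}.
    by move=> t0; apply: continuousM; [exact: cF|exact: cst_continuous].
  split.
  + move=> t; rewrite in_itv/= => /andP[et _].
    by have [] := dF t (lt_trans e0 et).
  + by apply: cvg_at_right_filter; exact: cG.
  + by apply: cvg_at_left_filter; apply: cG.
- move=> t; rewrite in_itv/= => /andP[et _].
  by rewrite derive1E; have [_ ->] := dF t (lt_trans e0 et).
Qed.

Lemma integral_powR_lty x : 0 < x ->
  (\int[mu]_(t in `]0%R, 1%R]) (t `^ (x - 1))%:E < +oo)%E.
Proof.
move=> x0; apply: (@le_lt_trans _ _ (x^-1)%:E); last exact: ltry.
(* For [x < 1] the integrand is singular at 0, hence the exhaustion from the right. The index [n.+2]
   keeps the left end strictly below 1, and the bound [x^-1] is uniform in it. *)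
pose F n : set R := `[n.+2%:R^-1, 1]%classic.
have -> : `]0%R, 1%R]%classic = \bigcup_n F n.
  apply/seteqP; split => t /=.
    rewrite in_itv/= => /andP[t0 t1].
    have [n _ nt] := near_infty_natSinv_lt (PosNum t0).
    exists n => //; rewrite /F/= in_itv/= t1 andbT.
    apply: le_trans (ltW (nt n (leqnn _))).
    by rewrite lef_pV2 ?posrE// ler_nat.
  move=> [n _]; rewrite /F/= !in_itv/= => /andP[nt ->]; rewrite andbT.
  by apply: lt_le_trans nt; rewrite invr_gt0.
have cF : (\int[mu]_(t in F n) (t `^ (x - 1))%:E @[n --> \oo] -->
    \int[mu]_(t in \bigcup_n F n) (t `^ (x - 1))%:E)%E.
  apply: ge0_nondecreasing_set_cvg_integral => //.
  - apply/nondecreasing_seqP => n; rewrite subsetEset => t.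
    rewrite /F/= !in_itv/= => /andP[nt ->]; rewrite andbT.
    by apply: le_trans nt; rewrite lef_pV2 ?posrE// ler_nat.
  - by move=> n; exact: measurable_itv.
  - by move=> n; exact: measurable_powRE.
  - by move=> n t _; rewrite lee_fin powR_ge0.
rewrite -(cvg_lim _ cF)//; apply: lime_le; first by apply/cvg_ex; eexists; exact: cF.
apply: nearW => n; apply: integral_powR_cc => //.
by rewrite invr_gt0 ltr0n/= invf_lt1// ltr1n.
Qed.

(** The rate 1/2 leaves half of the decay of exp(-t) to make the tail of the Gamma integral
    converge. *)
Let powR_le_expR (a t : R) : 1 <= t ->
  t `^ a <= expR (`|a| * (2 * `|a| + 1)) * expR (t / 2).
Proof.
move=> t1; have t0 : 0 < t by exact: lt_le_trans t1.
rewrite /powR gt_eqF// -expRD ler_expR.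
have lt0 : 0 <= ln t by exact: ln_ge0.
apply: (@le_trans _ _ (`|a| * ln t)); first by rewrite ler_wpM2r// ler_norm.
(* Since ln t = ln (t / b) + ln b <= t / b + b, the slope |a| / b must be at most 1/2; the added 1
   keeps [b] positive at [a = 0]. *)
pose b := 2 * `|a| + 1.
have a0 := normr_ge0 a.
have b0 : 0 < b by rewrite /b; lra.
have lnE : ln t = ln (t / b) + ln b.
  by rewrite -lnM ?posrE ?divr_gt0// divfK// gt_eqF.
have l1 : ln (t / b) <= t / b by apply/ltW/ln_sublinear/divr_gt0.
have l2 : ln b <= b by apply/ltW/ln_sublinear.
have l3 : `|a| * (t / b) <= t / 2.
  rewrite mulrCA ler_wpM2l ?(ltW t0)// ler_pdivrMr// /b; lra.
apply: (@le_trans _ _ (`|a| * (t / b + b))).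
  by rewrite ler_wpM2l// lnE lerD.
by rewrite mulrDr addrC lerD2l.
Qed.

Lemma Gamma_integral_lty x : 0 < x ->
  (\int[mu]_(t in `]0%R, +oo[) (t `^ (x - 1) * expR (- t))%:E < +oo)%E.
Proof.
move=> x0; have mk D := measurable_Gamma_kernel x 1 (D := D).
under eq_integral do rewrite -[X in expR (- X)]mul1r.
rewrite (_ : `]0%R, +oo[%classic = `]0%R, 1%R] `|` `]1%R, +oo[); last first.
  by rewrite -itv_bndbnd_setU// bnd_simp.
rewrite ge0_integral_setU//=; first last.
- apply/disj_setPS => t []/=; rewrite !in_itv/= => /andP[_ t1].
  by rewrite andbT ltNge t1.
- by move=> t _; exact: Gamma_kernel_ge0.
- exact: mk.
apply: lte_add_pinfty.
  apply: le_lt_trans (integral_powR_lty x0); apply: ge0_le_integral => //=.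
  - by move=> t _; exact: Gamma_kernel_ge0.
  - exact: mk.
  - exact: measurable_powRE.
  - move=> t; rewrite in_itv/= => /andP[t0 _]; rewrite lee_fin ler_piMr ?powR_ge0//.
    by rewrite -[leRHS]expR0 ler_expR mul1r oppr_le0 ltW.
(* The tail is compared with the exponential density of rate 1/2; the factor 2 cancels the rate
   standing in front of that density. *)
pose C : R := 2 * expR (`|x - 1| * (2 * `|x - 1| + 1)).
have C0 : 0 <= C by rewrite mulr_ge0 ?expR_ge0.
have half0 : (0 : R) < 2^-1 by rewrite invr_gt0.
have me : measurable_fun setT (EFin \o exponential_pdf (2^-1 : R)).
  by apply/measurable_EFinP; exact: measurable_exponential_pdf.
apply: (@le_lt_trans _ _ (\int[mu]_t (C%:E * (exponential_pdf 2^-1 t)%:E))%E); last first.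
  rewrite ge0_integralZl_EFin//.
  - by rewrite integral_exponential_pdf// mule1 ltry.
  - by move=> t _; rewrite lee_fin exponential_pdf_ge0// ltW.
apply: (@le_trans _ _ (\int[mu]_(t in `]1%R, +oo[) (C%:E * (exponential_pdf 2^-1 t)%:E))%E).
  apply: ge0_le_integral => //=.
  - by move=> t _; exact: Gamma_kernel_ge0.
  - exact: mk.
  - by apply: emeasurable_funM => //; exact: measurable_funTS.
  - move=> t; rewrite in_itv/= andbT => t1.
    have t0 : 0 <= t by lra.
    rewrite lee_fin exponential_pdfE// mul1r /C.
    apply: (@le_trans _ _ (expR (`|x - 1| * (2 * `|x - 1| + 1)) * expR (t / 2) * expR (- t))).
      by rewrite ler_wpM2r ?expR_ge0// powR_le_expR// ltW.
    rewrite -mulrA -expRD (_ : t / 2 - t = - 2^-1 * t); last by field.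
    by rewrite [leRHS]mulrACA divff// mul1r.
apply: ge0_subset_integral => //=.
- by apply: emeasurable_funM.
- by move=> t _; rewrite mule_ge0// lee_fin// exponential_pdf_ge0// ltW.
Qed.

Lemma Gamma_integralE x : 0 < x ->
  (\int[mu]_(t in `]0%R, +oo[) (t `^ (x - 1) * expR (- t))%:E = (Gamma x)%:E)%E.
Proof.
move=> x0; rewrite /Gamma fineK// ge0_fin_numE ?Gamma_integral_lty//.
by apply: integral_ge0 => t _; rewrite lee_fin mulr_ge0 ?powR_ge0 ?expR_ge0.
Qed.

Lemma Gamma_gt0 x : 0 < x -> 0 < Gamma x.
Proof.
move=> x0; rewrite -lte_fin -Gamma_integralE//.
(* A lower bound for the integrand on [1, 2]: there 0 <= ln t <= t <= 2, so t^(x - 1) is at least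
   exp(-2 |x - 1|). *)
pose c := expR (- (`|x - 1| * 2) - 2).
apply: (@lt_le_trans _ _ (\int[mu]_(t in `[1%R, 2%R]) c%:E)%E).
  have muE : mu `[1, 2]%classic = 1%E.
    by rewrite lebesgue_measure_itv/= lte_fin ltr1n -EFinB; congr EFin; lra.
  by rewrite integral_cst//= muE mule1 lte_fin expR_gt0.
have mk D := measurable_Gamma_kernel x 1 (D := D).
under [leRHS]eq_integral do rewrite -[X in expR (- X)]mul1r.
apply: (@le_trans _ _ (\int[mu]_(t in `[1%R, 2%R])
    (t `^ (x - 1) * expR (- (1 * t)))%:E)%E).
  apply: ge0_le_integral => //=.
  - by move=> t _; rewrite lee_fin expR_ge0.
  - exact: mk.
  - move=> t; rewrite in_itv/= => /andP[t1 t2].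
    have t0 : 0 < t by lra.
    rewrite lee_fin /c mul1r expRD ler_pM ?expR_ge0//; last first.
      by rewrite ler_expR lerN2.
    rewrite /powR gt_eqF// ler_expR lerNl.
    have ln0 : 0 <= ln t by exact: ln_ge0.
    rewrite -mulNr; apply: (@le_trans _ _ (`|x - 1| * ln t)).
      by rewrite ler_wpM2r// -normrN ler_norm.
    rewrite ler_wpM2l ?normr_ge0//.
    by apply: (@le_trans _ _ t) => //; apply/ltW/ln_sublinear.
apply: ge0_subset_integral => //=.
- exact: mk.
- by move=> t _; exact: Gamma_kernel_ge0.
- by move=> t /=; rewrite !in_itv/= andbT => /andP[t1 _]; exact: lt_le_trans t1.
Qed.

Let mem_itv0y t : (t \in `]0, +oo[%classic) = (0 < t).
Proof. by apply/idP/idP; rewrite inE/= in_itv/= andbT. Qed.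

Lemma Gamma_scale x c : 0 < x -> 0 < c ->
  (\int[mu]_(t in `]0%R, +oo[) (t `^ (x - 1) * expR (- (c * t)))%:E =
   (c `^ (- x) * Gamma x)%:E)%E.
Proof.
move=> x0 c0; have mk D c' := measurable_Gamma_kernel x c' (D := D).
have cx0 : 0 < c `^ x by exact: powR_gt0.
suff : ((c `^ x)%:E * \int[mu]_(t in `]0%R, +oo[)
    (t `^ (x - 1) * expR (- (c * t)))%:E = (Gamma x)%:E)%E.
  move=> E; rewrite EFinM -E muleA -EFinM powRN mulVf ?mul1e//.
  by rewrite gt_eqF.
rewrite -Gamma_integralE// [RHS]integral_mkcond.
rewrite [RHS](@ge0_integral_affine _ c 0) ?gt_eqF//; first last.
- move=> t; apply: erestrict_ge0 => {}t _.
  by rewrite lee_fin mulr_ge0 ?powR_ge0 ?expR_ge0.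
- apply/(measurable_restrictT _ _).1 => //.
  by apply: eq_measurable_fun (mk _ 1) => u _; rewrite mul1r.
rewrite integral_mkcond -ge0_integralZl_EFin//; first last.
- exact: powR_ge0.
- by apply/(measurable_restrictT _ _).1 => //; exact: mk.
- by move=> t _; apply: erestrict_ge0 => {}t _; exact: Gamma_kernel_ge0.
rewrite -ge0_integralZl_EFin//; first last.
- have -> : (fun t => (fun u => (u `^ (x - 1) * expR (- u))%:E) \_ `]0%R, +oo[
      (c * t + 0)%R) = ((fun t => (c `^ (x - 1))%:E *
      (t `^ (x - 1) * expR (- (c * t)))%:E) \_ `]0%R, +oo[)%E.
    apply/funext => t; rewrite addr0 /patch !mem_itv0y pmulr_rgt0//.
    case: ltP => // t0.
    by rewrite -EFinM powRM ?(ltW c0) ?(ltW t0)// mulrA.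
  apply/(measurable_restrictT _ _).1 => //; apply: emeasurable_funM => //.
  exact: mk.
- move=> t _; apply: erestrict_ge0 => {}t _.
  by rewrite lee_fin mulr_ge0 ?powR_ge0 ?expR_ge0.
apply: eq_integral => t _; rewrite addr0 /patch !mem_itv0y pmulr_rgt0//.
case: ltP => t0; last by rewrite !mule0.
rewrite -!EFinM; congr EFin.
rewrite powRM ?(ltW c0) ?(ltW t0)// gtr0_norm// !mulrA; congr (_ * _ * _).
by rewrite mulr_powRB1// ltW.
Qed.

End gamma_function.

(** * Moments of rectified Gaussian vectors *)

Section gauss_smooth.
Context {R : realType}.
Local Notation mu := (@lebesgue_measure R).
Local Notation gauss := (normal_prob (0 : R) 1).
Implicit Types (c q r : R) (f g : R -> \bar R).

(** The same walk without rectification. At [c = 1/2] an increment has the Gamma law of shape 1/2,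
    so the n-th iterate at 0 integrates [f] against the Gamma law of shape n/2 for [n > 0]. *)
Definition gauss_smooth c f q : \bar R :=
  (\int[gauss]_z f (q + c * z ^+ 2)%R)%E.

Let measurable_shift (dS : measure_display) (S : measurableType dS) c
    (u : S -> R) : measurable_fun setT u ->
  measurable_fun setT (fun w : S * R => u w.1 + c * w.2 ^+ 2).
Proof.
move=> mu_; apply: measurable_funD; first exact: measurableT_comp.
by apply: measurable_funM => //; exact: measurable_funX.
Qed.

Let measurable_shift1 c q : measurable_fun setT (fun z : R => q + c * z ^+ 2).
Proof.
apply: measurable_funD => //.
by apply: measurable_funM => //; exact: measurable_funX.
Qed.

Lemma iter_gauss_smooth_ge0 n c f : (forall q, (0 <= f q)%E) ->
  forall q, (0 <= iter n (gauss_smooth c) f q)%E.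
Proof.
by move=> f0; elim: n => [|n IH] q //=; apply: integral_ge0 => z _; exact: IH.
Qed.

Lemma measurable_iter_gauss_smooth_param (dS : measure_display)
    (S : measurableType dS) n c (F : S * R -> \bar R) :
  measurable_fun setT F -> (forall w, (0 <= F w)%E) ->
  measurable_fun setT
    (fun w : S * R => iter n (gauss_smooth c) (fun v => F (w.1, v)) w.2).
Proof.
move=> mF F0; elim: n => [|n IH] /=.
  by apply: eq_measurable_fun mF => -[].
apply: (@measurable_fun_gauss_int _ _ _ (fun w : S * R * R =>
  iter n (gauss_smooth c) (fun v => F (w.1.1, v)) (w.1.2 + c * w.2 ^+ 2))).
- have mg : measurable_fun setT (fun w : S * R * R =>
      (w.1.1, w.1.2 + c * w.2 ^+ 2)).
    apply: measurable_fun_pair; first exact: measurableT_comp.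
    exact: measurable_shift.
  exact: (measurableT_comp IH mg).
- by move=> w; apply: iter_gauss_smooth_ge0.
Qed.

Lemma measurable_iter_gauss_smooth n c f :
  measurable_fun setT f -> (forall q, (0 <= f q)%E) ->
  measurable_fun setT (iter n (gauss_smooth c) f).
Proof.
move=> mf f0.
have mF : measurable_fun setT (fun w : R * R => f w.2) by exact: measurableT_comp.
exact: (measurableT_comp (measurable_iter_gauss_smooth_param n c mF
  (fun w => f0 _)) (measurable_fun_pair (@measurable_id _ _ _) (@measurable_id _ _ _))).
Qed.

(** From a nonnegative start the walk stays nonnegative, so integrals evaluated only for [q >= 0]
    can be substituted under the iterate. *)
Lemma eq_iter_gauss_smooth n c f g : 0 <= c ->
  (forall q, 0 <= q -> f q = g q) ->
  forall q, 0 <= q -> iter n (gauss_smooth c) f q = iter n (gauss_smooth c) g q.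
Proof.
move=> c0 fg; elim: n => [|n IH] q q0 /=; first exact: fg.
apply: eq_integral => z _; apply: IH.
by rewrite addr_ge0// mulr_ge0// sqr_ge0.
Qed.

Lemma iter_gauss_smoothZ n c f (k : R) q : 0 <= k ->
  measurable_fun setT f -> (forall q, (0 <= f q)%E) ->
  (iter n (gauss_smooth c) (fun w => k%:E * f w) q =
   k%:E * iter n (gauss_smooth c) f q)%E.
Proof.
move=> k0 mf f0; elim: n q => [|n IH] q //=; rewrite /gauss_smooth.
under eq_integral do rewrite IH.
rewrite ge0_integralZl_EFin//.
- by move=> z _; exact: iter_gauss_smooth_ge0.
- apply: (measurableT_comp (measurable_iter_gauss_smooth n c mf f0)).
  exact: measurable_shift1.
Qed.

Lemma iter_gauss_smooth_integral n c (F : R * R -> \bar R) q :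
  measurable_fun setT F -> (forall w, (0 <= F w)%E) ->
  (\int[mu]_l iter n (gauss_smooth c) (fun w => F (l, w)) q =
   iter n (gauss_smooth c) (fun w => \int[mu]_l F (l, w)) q)%E.
Proof.
move=> mF F0; elim: n q => [|n IH] q //=.
rewrite [RHS]/gauss_smooth.
under [RHS]eq_integral do rewrite -IH.
have mG : measurable_fun setT (fun w : R * R =>
    iter n (gauss_smooth c) (fun v => F (w.1, v)) (q + c * w.2 ^+ 2)).
  have mg : measurable_fun setT (fun w : R * R => (w.1, q + c * w.2 ^+ 2)).
    apply: measurable_fun_pair => //.
    exact: (measurableT_comp (measurable_shift1 c q)).
  exact: (measurableT_comp (measurable_iter_gauss_smooth_param n c mF F0) mg).
rewrite -(@fubini_tonelli _ _ _ _ _ mu gauss _ mG)//.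
by move=> w; exact: iter_gauss_smooth_ge0.
Qed.

Lemma relu_smoothE r f q : 0 <= r ->
  measurable_fun setT f -> (forall q, (0 <= f q)%E) ->
  (relu_smooth r f q = (2^-1)%:E * (f q + gauss_smooth (r ^+ 2) f q))%E.
Proof.
move=> r0 mf f0.
have mh : measurable_fun setT (fun w : R => f (q + r ^+ 2 * w)).
  by apply: (measurableT_comp mf); apply: measurable_funD.
have := ge0_integral_gauss_relu mh (fun w => f0 _).
rewrite mulr0 addr0 => <-; apply: eq_integral => z _.
congr (f (_ + _)); rewrite -exprMn; congr (_ ^+ 2).
rewrite /prelu !mul0r; have [->|rn0] := eqVneq r 0.
  by rewrite !mul0r; case: ifP.
rewrite pmulr_rgt0 ?lt0r ?rn0//.
by case: ifP; rewrite ?mulr0.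
Qed.

(* binomial expansion of the operator power [((id + gauss_smooth) / 2) ^ d] *)
Lemma iter_relu_smooth d r f q : 0 <= r ->
  measurable_fun setT f -> (forall q, (0 <= f q)%E) ->
  (iter d (relu_smooth r) f q = \sum_(n < d.+1)
     ('C(d, n)%:R / 2 ^+ d)%:E * iter n (gauss_smooth (r ^+ 2)) f q)%E.
Proof.
move=> r0 mf f0; elim: d q => [|d IH] q.
  by rewrite big_ord1/= bin0 divr1 mul1e.
set L := gauss_smooth (r ^+ 2); pose a k n : R := 'C(k, n)%:R / 2 ^+ k.
have a0 k n : (0 <= (a k n)%:E)%E by rewrite lee_fin divr_ge0// exprn_ge0.
have Lf0 n q' : (0 <= iter n L f q')%E by exact: iter_gauss_smooth_ge0.
have mLf n : measurable_fun setT (iter n L f).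
  exact: measurable_iter_gauss_smooth.
pose G q' := (\sum_(n < d.+1) (a d n)%:E * iter n L f q')%E.
have mG : measurable_fun setT G.
  by apply: emeasurable_sum => n; apply: emeasurable_funM.
have G0 q' : (0 <= G q')%E by apply: sume_ge0 => n _; rewrite mule_ge0.
rewrite iterS (_ : iter d (relu_smooth r) f = G); last exact/funext.
rewrite relu_smoothE//.
have -> : gauss_smooth (r ^+ 2) G q = (\sum_(n < d.+1) (a d n)%:E * iter n.+1 L f q)%E.
  rewrite /gauss_smooth /G ge0_integral_sum//.
  - apply: eq_bigr => n _; rewrite ge0_integralZl_EFin//.
    + exact: (measurableT_comp (mLf n) (measurable_shift1 _ _)).
    + by rewrite -lee_fin.
  - move=> n; apply: emeasurable_funM => //.
    exact: (measurableT_comp (mLf n) (measurable_shift1 _ _)).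
  - by move=> n z _; rewrite mule_ge0.
(* Pascal's rule for the normalized binomial weights. *)
have aS n : a d.+1 n.+1 = 2^-1 * a d n.+1 + 2^-1 * a d n.
  by rewrite /a binS natrD exprS; field; rewrite expf_neq0.
have half0 n : 0 <= 2^-1 * a d n by rewrite mulr_ge0// ?invr_ge0// -lee_fin.
have half_sum (b : nat -> R) (u : nat -> \bar R) N : (forall n, (0 <= u n)%E) ->
    (forall n, 0 <= b n) ->
    ((2^-1)%:E * \sum_(n < N) (b n)%:E * u n =
     \sum_(n < N) (2^-1 * b n)%:E * u n)%E.
  move=> u0 b0; rewrite ge0_sume_distrr; last first.
    by move=> n _; rewrite mule_ge0// lee_fin.
  by apply: eq_bigr => n _; rewrite muleA.
rewrite ge0_muleDr//; last by apply: sume_ge0 => n _; rewrite mule_ge0.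
have ad0 n : 0 <= a d n by rewrite -lee_fin.
rewrite /G (half_sum (a d) (fun n => iter n L f q))//.
rewrite (half_sum (a d) (fun n => iter n.+1 L f q))//.
rewrite [RHS]big_ord_recl.
have -> : (\sum_(n < d.+1) ('C(d.+1, lift ord0 n)%:R / 2 ^+ d.+1)%:E *
    iter (lift ord0 n) L f q =
  \sum_(n < d.+1) (2^-1 * a d n.+1)%:E * iter n.+1 L f q +
  \sum_(n < d.+1) (2^-1 * a d n)%:E * iter n.+1 L f q)%E.
  rewrite -big_split/=; apply: eq_bigr => n _.
  rewrite /bump/= add1n -/(a d.+1 n.+1) aS EFinD ge0_muleDl//.
  - by rewrite lee_fin.
  - by rewrite lee_fin.
rewrite addeA; congr (_ + _)%E.
rewrite [in LHS]big_ord_recl big_ord_recr/=.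
(* The shifted sum runs up to index [d.+1], where the binomial coefficient vanishes; without that
   term it is the tail of the unshifted sum. *)
have -> : a d d.+1 = 0 by rewrite /a bin_small// mul0r.
rewrite mulr0 mul0e adde0; congr (_ + _)%E.
by rewrite /a !bin0 exprS invfM !mul1r.
Qed.

End gauss_smooth.

(** * Moments of a sum of halved Gaussian squares *)

Section chi_moment.
Context {R : realType}.
Local Notation mu := (@lebesgue_measure R).
Local Notation gauss := (normal_prob (0 : R) 1).
Implicit Types (a b c l p q : R).

Let measurable_powRE p : measurable_fun setT (fun w : R => (w `^ p)%:E).
Proof. by apply/measurable_EFinP; exact: measurable_powR. Qed.

Let powRE_ge0 p w : (0 <= (w `^ p)%:E)%E.
Proof. by rewrite lee_fin powR_ge0. Qed.

Lemma iter_gauss_smooth_powR n a c p q : 0 <= a -> 0 <= c -> 0 <= q ->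
  (iter n (gauss_smooth (a * c)) (fun w => (w `^ p)%:E) (a * q)%R =
   (a `^ p)%:E * iter n (gauss_smooth c) (fun w => (w `^ p)%:E) q)%E.
Proof.
move=> a0 c0; elim: n q => [|n IH] q q0 /=; first by rewrite -EFinM powRM.
have qz z : 0 <= q + c * z ^+ 2 by rewrite addr_ge0// mulr_ge0// sqr_ge0.
rewrite /gauss_smooth.
under eq_integral do rewrite -mulrA -mulrDr IH//.
rewrite ge0_integralZl_EFin ?powR_ge0//.
- by move=> z _; exact: iter_gauss_smooth_ge0.
- have mL := measurable_iter_gauss_smooth n c (measurable_powRE p) (powRE_ge0 p).
  apply: (measurableT_comp mL); apply: measurable_funD => //.
  by apply: measurable_funM => //; exact: measurable_funX.
Qed.

Lemma iter_gauss_smooth_cst n c (x : \bar R) q :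
  iter n (gauss_smooth c) (fun=> x) q = x.
Proof.
elim: n q => [//|n IH] q /=; rewrite /gauss_smooth.
by under eq_integral do rewrite IH; rewrite integral_gauss_cst.
Qed.

(** The exponential factors over the start and the increments. Each increment pays (1 + l)^(-1/2)
    and has its Gaussian shrunk by that factor, hence its square by 1 / (1 + l). *)
Lemma iter_gauss_smooth_tilt n l (f : R -> \bar R) q : 0 <= l ->
  measurable_fun setT f -> (forall w, (0 <= f w)%E) ->
  (iter n (gauss_smooth 2^-1) (fun w => f w * (expR (- (l * w)))%:E) q =
   ((Num.sqrt (1 + l))^-1 ^+ n * expR (- (l * q)))%:E *
   iter n (gauss_smooth ((1 + l)^-1 * 2^-1)) f q)%E.
Proof.
move=> l0 mf f0; set k := (Num.sqrt (1 + l))^-1.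
have k0 : 0 <= k by rewrite invr_ge0.
have k2 : k ^+ 2 = (1 + l)^-1 by rewrite exprVn sqr_sqrtr// addr_ge0.
elim: n q => [|n IH] q /=; first by rewrite expr0 mul1r muleC.
rewrite /gauss_smooth -/(gauss_smooth _).
set G := iter n (gauss_smooth ((1 + l)^-1 * 2^-1)) f.
have mG : measurable_fun setT G by exact: measurable_iter_gauss_smooth.
have G0 w : (0 <= G w)%E by exact: iter_gauss_smooth_ge0.
have mh : measurable_fun setT (fun z : R => G (q + z ^+ 2 / 2)).
  apply: (measurableT_comp mG); apply: measurable_funD => //.
  by apply: measurable_funM => //; exact: measurable_funX.
have mexp : measurable_fun setT (fun z : R => (expR (- (l * (z ^+ 2 / 2))))%:E).
  apply/measurable_EFinP; apply: measurableT_comp => //.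
  apply: measurableT_comp => //; apply: measurable_funM => //.
  by apply: measurable_funM => //; exact: measurable_funX.
transitivity (\int[gauss]_z ((k ^+ n * expR (- (l * q)))%:E *
    (G (q + z ^+ 2 / 2)%R * (expR (- (l * (z ^+ 2 / 2))))%:E)))%E.
  apply: eq_integral => z _; rewrite IH -/G (mulrC 2^-1).
  rewrite [(G _ * _)%E]muleC muleA -EFinM; congr (_%:E * _)%E.
  by rewrite mulrDr opprD expRD [LHS]mulrA.
have kn0 : 0 <= k ^+ n * expR (- (l * q)) by rewrite mulr_ge0 ?exprn_ge0 ?expR_ge0.
rewrite ge0_integralZl_EFin//; first last.
- exact: emeasurable_funM.
- by move=> z _; rewrite mule_ge0// lee_fin expR_ge0.
rewrite (ge0_integral_gauss_tilt l0 mh (fun z => G0 _)) -/k muleA -EFinM.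
congr (_%:E * _)%E; first by rewrite exprSr; ring.
apply: eq_integral => z _; congr (G (_ + _)).
by rewrite exprMn k2 mulrAC.
Qed.

Let measurable_if0 (dS : measure_display) (S : measurableType dS)
    (u : S -> R) (F : S -> \bar R) :
  measurable_fun setT u -> measurable_fun setT F ->
  measurable_fun setT (fun y => if 0 < u y then F y else 0%E).
Proof.
move=> mu_ mF; apply: measurable_fun_ifT => //.
exact: measurable_fun_ltr.
Qed.

(** One increment is already positive off the null set {0}. With no increment a walk started at 0
    would stay there, hence [n.+1]. *)
Lemma iter_gauss_smooth_pos n q : 0 <= q ->
  iter n.+1 (gauss_smooth 2^-1) (fun w : R => if 0 < w then 1%E else 0%E) q = 1%E.
Proof.
elim: n q => [|n IH] q q0.
  rewrite /= /gauss_smooth -[RHS](integral_gauss_cst 1%E).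
  apply: ge0_ae_eq_integral => //=.
  - apply: measurable_if0 => //; apply: measurable_funD => //.
    by apply: measurable_funM => //; exact: measurable_funX.
  - by move=> z _; case: ifP.
  - exists [set 0 : R]; split => //.
      by apply: integral_set1.
    move=> z /=; apply: contra_notP => /eqP z0 _; rewrite ifT//.
    by rewrite ltr_wpDl// mulr_gt0 ?invr_gt0// exprn_even_gt0.
rewrite iterS /gauss_smooth -[RHS](integral_gauss_cst 1%E).
apply: eq_integral => z _; apply: IH.
by rewrite addr_ge0// mulr_ge0 ?invr_ge0// sqr_ge0.
Qed.

Let integral0y (f : R -> \bar R) :
  (\int[mu]_(t in `]0%R, +oo[) f t = \int[mu]_t (if (0 < t)%R then f t else 0))%E.
Proof.
rewrite integral_mkcond; apply: eq_integral => t _; rewrite /patch.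
by rewrite (_ : (t \in _) = (0 < t))//; apply/idP/idP; rewrite inE/= in_itv/= andbT.
Qed.

(** A Beta integral. Multiplying by Gamma(b + p) writes the power of 1 + l as an integral of t^(b +
    p - 1) exp(-(1 + l) t); after Tonelli, integrating in l gives Gamma(p) t^(-p), and Gamma(b) is
    left. *)
Lemma Gamma_beta p b : 0 < p -> 0 < b ->
  (\int[mu]_(l in `]0%R, +oo[) (l `^ (p - 1) * (1 + l) `^ (- (b + p)))%:E =
   (Gamma p * Gamma b / Gamma (b + p))%:E)%E.
Proof.
move=> p0 b0; have bp0 : 0 < b + p by exact: addr_gt0.
have G0 := Gamma_gt0 bp0.
set B := (\int[mu]_(l in _) _)%E.
suff E : ((Gamma (b + p))%:E * B = (Gamma p * Gamma b)%:E)%E.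
  rewrite -[B]mul1e -(_ : (Gamma (b + p))^-1%:E * (Gamma (b + p))%:E = 1)%E.
    by rewrite -muleA E -EFinM mulrC.
  by rewrite -EFinM mulVf// gt_eqF.
pose F (w : R * R) : \bar R := if 0 < w.1 then if 0 < w.2 then
  (w.1 `^ (p - 1) * (w.2 `^ (b + p - 1) * expR (- ((1 + w.1) * w.2))))%:E
  else 0%E else 0%E.
have F0 w : (0 <= F w)%E.
  by rewrite /F; do 2 case: ifP => // _; rewrite lee_fin !mulr_ge0 ?powR_ge0 ?expR_ge0.
have mF : measurable_fun setT F.
  do 2 apply: measurable_if0 => //.
  apply/measurable_EFinP; apply: measurable_funM.
    exact: (measurableT_comp (measurable_powR _)).
  apply: measurable_funM; first exact: (measurableT_comp (measurable_powR _)).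
  apply: measurableT_comp => //; apply: measurableT_comp => //.
  by apply: measurable_funM => //; apply: measurable_funD.
transitivity (\int[mu]_l \int[mu]_t F (l, t))%E.
  rewrite -ge0_integralZl_EFin ?(ltW G0)//; last 2 first.
    by move=> l _; rewrite lee_fin mulr_ge0 ?powR_ge0.
    apply: measurable_funTS; apply/measurable_EFinP; apply: measurable_funM.
      exact: measurable_powR.
    apply: (measurableT_comp (measurable_powR _)); exact: measurable_funD.
  rewrite integral0y; apply: eq_integral => l _; rewrite /F/=.
  case: ltP => l0; last by rewrite integral0_eq.
  rewrite -integral0y; under [RHS]eq_integral do rewrite EFinM.
  rewrite ge0_integralZl_EFin ?powR_ge0//; last 2 first.
    by move=> t _; exact: Gamma_kernel_ge0.
    exact: measurable_Gamma_kernel.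
  rewrite Gamma_scale// ?addr_gt0// -!EFinM; congr EFin; ring.
rewrite (@fubini_tonelli _ _ _ _ _ mu mu _ mF F0).
transitivity (\int[mu]_(t in `]0%R, +oo[) ((Gamma p)%:E *
    (t `^ (b - 1) * expR (- t))%:E))%E.
  rewrite [RHS]integral0y; apply: eq_integral => t _; rewrite /F/=.
  case: ltP => t0; last first.
    by rewrite integral0_eq// => l _; case: ifP.
  rewrite -integral0y.
  transitivity (\int[mu]_(l in `]0%R, +oo[) ((t `^ (b + p - 1) * expR (- t))%:E *
      (l `^ (p - 1) * expR (- (t * l)))%:E))%E.
    apply: eq_integral => l _; rewrite -EFinM; congr EFin.
    by rewrite mulrDl mul1r opprD expRD (mulrC l t); ring.
  rewrite ge0_integralZl_EFin//; last 3 first.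
    by move=> l _; exact: Gamma_kernel_ge0.
    exact: measurable_Gamma_kernel.
    by rewrite mulr_ge0 ?powR_ge0 ?expR_ge0.
  rewrite Gamma_scale// -!EFinM; congr EFin.
  rewrite (_ : b + p - 1 = b - 1 + p); last by ring.
  rewrite powRD ?(gt_eqF t0) ?implybT// powRN.
  by field; rewrite gt_eqF// powR_gt0.
rewrite ge0_integralZl_EFin ?(ltW (Gamma_gt0 p0))//; last 2 first.
  by move=> t _; rewrite lee_fin mulr_ge0 ?powR_ge0 ?expR_ge0.
  by apply: eq_measurable_fun (measurable_Gamma_kernel b 1 (D := _)) => t _;
    rewrite mul1r.
by rewrite Gamma_integralE// -EFinM.
Qed.

(* The tilted moment, weighted by [l ^ (p - 1)] and integrated over [l > 0], can be
   computed in two ways: by scaling it is the moment times a Beta integral, and by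
   exchanging the integrals it is [Gamma p]. *)
Lemma chi_moment n p : 0 < p ->
  iter n.+1 (gauss_smooth 2^-1) (fun w : R => (w `^ p)%:E) 0 =
  (Gamma (n.+1%:R / 2 + p) / Gamma (n.+1%:R / 2))%:E.
Proof.
move=> p0; set A := iter _ _ _ _; set b : R := n.+1%:R / 2.
have b0 : 0 < b by rewrite divr_gt0.
have bp0 : 0 < b + p by exact: addr_gt0.
have A0 : (0 <= A)%E by exact: iter_gauss_smooth_ge0.
pose F (w : R * R) : \bar R := if 0 < w.1 then
  ((w.1 `^ (p - 1))%:E * ((w.2 `^ p)%:E * (expR (- (w.1 * w.2)))%:E))%E else 0%E.
have F0 w : (0 <= F w)%E.
  by rewrite /F; case: ifP => // _; rewrite -!EFinM lee_fin !mulr_ge0 ?powR_ge0 ?expR_ge0.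
have mF : measurable_fun setT F.
  apply: measurable_if0 => //; apply: emeasurable_funM.
    exact: (measurableT_comp (measurable_powRE _)).
  apply: emeasurable_funM; first exact: (measurableT_comp (measurable_powRE _)).
  apply/measurable_EFinP; apply: measurableT_comp => //.
  by apply: measurableT_comp => //; apply: measurable_funM.
have AE : (\int[mu]_l iter n.+1 (gauss_smooth 2^-1) (fun w => F (l, w)) 0%R =
    A * (Gamma p * Gamma b / Gamma (b + p))%:E)%E.
  rewrite -Gamma_beta// integral0y -ge0_integralZl//; first last.
  - by move=> l _; case: ifP => // _; rewrite lee_fin mulr_ge0 ?powR_ge0.
  - apply: measurable_if0 => //; apply/measurable_EFinP; apply: measurable_funM.
      exact: measurable_powR.
    by apply: (measurableT_comp (measurable_powR _)); apply: measurable_funD.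
  apply: eq_integral => l _; have [l0|l0] := ltP 0 l; last first.
    rewrite (_ : (fun w => _) = fun=> 0%E) ?iter_gauss_smooth_cst ?mule0//.
    by apply/funext => w; rewrite /F ltNge l0.
  rewrite (_ : (fun w => _) = fun w => ((l `^ (p - 1))%:E *
      ((w `^ p)%:E * (expR (- (l * w)))%:E))%E); last first.
    by apply/funext => w; rewrite /F l0.
  have l10 : 0 < 1 + l by exact: addr_gt0.
  have me : measurable_fun setT (fun w : R => (expR (- (l * w)))%:E).
    apply/measurable_EFinP; apply: measurableT_comp => //.
    by apply: measurableT_comp => //; apply: measurable_funM.
  rewrite iter_gauss_smoothZ ?powR_ge0//; first last.
  - by move=> w; rewrite -EFinM lee_fin mulr_ge0 ?powR_ge0 ?expR_ge0.
  - exact: emeasurable_funM.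
  rewrite iter_gauss_smooth_tilt ?(ltW l0)//.
  (* The start 0 is its own multiple by 1 / (1 + l), so homogeneity extracts the factor (1 + l)^(-p)
     and leaves [A]. *)
  rewrite -[X in iter _ _ _ X](mulr0 (1 + l)^-1) iter_gauss_smooth_powR//; last first.
    by rewrite invr_ge0 ltW.
  rewrite -/A !muleA -!EFinM muleC; congr (_ * _%:E)%E.
  rewrite mulr0 oppr0 expR0 mulr1 -mulrA; congr (_ * _).
  rewrite -powR12_sqrt ?(ltW l10)// -powRN -powR_mulrn ?powR_ge0// -powRrM.
  rewrite -(powR_inv1 (ltW l10)) -powRrM -powRD ?(gt_eqF l10) ?implybT//.
  by congr (_ `^ _); rewrite /b; field.
have BE : (iter n.+1 (gauss_smooth 2^-1) (fun w => \int[mu]_l F (l, w)) 0%R =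
    (Gamma p)%:E)%E.
  (* The integral of [F] in l is Gamma(p) for [w > 0] by scaling, but 0 at [w = 0] because of the
     factor 0^p; [pos] records this exception, which has probability zero. *)
  pose pos (w : R) : \bar R := if 0 < w then 1%E else 0%E.
  transitivity (iter n.+1 (gauss_smooth 2^-1) (fun w => (Gamma p)%:E * pos w)%E 0).
    apply: eq_iter_gauss_smooth => // w w0.
    rewrite -integral0y /pos; move: w0; rewrite le_eqVlt => /predU1P[<-|w0].
      rewrite ltxx mule0 integral0_eq// => l _.
      by rewrite powR0 ?gt_eqF// mul0e mule0.
    rewrite w0 mule1.
    transitivity (\int[mu]_(l in `]0%R, +oo[) ((w `^ p)%:E *
        (l `^ (p - 1) * expR (- (w * l)))%:E))%E.
      by apply: eq_integral => l _; rewrite -!EFinM (mulrC l w); congr EFin; ring.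
    rewrite ge0_integralZl_EFin ?powR_ge0//; last 2 first.
      by move=> l _; exact: Gamma_kernel_ge0.
      exact: measurable_Gamma_kernel.
    rewrite Gamma_scale// -EFinM mulrA powRN mulfV ?mul1r//.
    by rewrite gt_eqF// powR_gt0.
  rewrite iter_gauss_smoothZ ?(ltW (Gamma_gt0 p0))//.
  - by rewrite iter_gauss_smooth_pos// mule1.
  - by apply: measurable_if0.
  - by move=> w; rewrite /pos; case: ifP.
have := iter_gauss_smooth_integral n.+1 2^-1 0 mF F0; rewrite AE BE.
have Gp := Gamma_gt0 p0; have Gb := Gamma_gt0 b0; have Gbp := Gamma_gt0 bp0.
pose B := Gamma p * Gamma b / Gamma (b + p).
have B0 : B != 0 by rewrite gt_eqF// divr_gt0// mulr_gt0.
(* [A] could a priori be infinite. As [B] is a nonzero real, the product formula determines [A],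
   finiteness included. *)
move=> E; rewrite -[A]mule1 -[1%E]/((1 : R)%:E) -(mulfV B0) EFinM muleA E.
rewrite -EFinM; congr EFin; rewrite /B; field.
by rewrite !gt_eqF.
Qed.

End chi_moment.

(** * The growth factor of a layer and its dependence on the order of the moment *)

Section moment_factor.
Context {R : realType}.
Local Notation mu := (@lebesgue_measure R).
Implicit Types (s p r v b : R).

Lemma iter_relu_smooth_powR d s r : 0 <= r -> 0 < s ->
  iter d (relu_smooth r) (fun q : R => (q `^ (s / 2))%:E) 0 = (r `^ s * I0 s d)%:E.
Proof.
move=> r0 s0; have s20 : 0 < s / 2 by rewrite divr_gt0.
rewrite iter_relu_smooth//; last 2 first.
- by apply/measurable_EFinP; exact: measurable_powR.
- by move=> q; rewrite lee_fin powR_ge0.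
(* With no active coordinate the walk stays at 0 and 0^(s/2) = 0; this is why the sum in [I0] starts
   at 1. *)
rewrite big_ord_recl/= powR0 ?gt_eqF// mule0 add0e.
rewrite /I0 big_add1 big_mkord/= mulrA mulr_sumr -sumEFin; apply: eq_bigr => n _.
rewrite /bump/= add1n.
(* [chi_moment] concerns halved squares; the scale 2 r^2 left over produces r^s and the prefactor
   2^(s/2) of [I0]. *)
have r2E : r ^+ 2 = (2 * r ^+ 2) * 2^-1 by field.
have -> : (gauss_smooth (r ^+ 2) (iter n (gauss_smooth (r ^+ 2))
    (fun q : R => (q `^ (s / 2))%:E)) 0) = iter n.+1 (gauss_smooth (r ^+ 2))
    (fun q : R => (q `^ (s / 2))%:E) 0 by [].
rewrite {1}r2E -[X in iter _ _ _ X](mulr0 (2 * r ^+ 2)).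
rewrite iter_gauss_smooth_powR ?mulr_ge0 ?sqr_ge0//.
rewrite chi_moment// -!EFinM; congr EFin.
have -> : (2 * r ^+ 2) `^ (s / 2) = r `^ s * 2 `^ (s / 2).
  rewrite powRM ?sqr_ge0// mulrC -powR_mulrn// -powRrM; congr (_ `^ _ * _).
  by field.
ring.
Qed.

Lemma I0_gt0 s d : 0 < s -> (0 < d)%N -> 0 < I0 s d.
Proof.
move=> s0; case: d => // d _; rewrite mulr_gt0 ?powR_gt0//.
have G0 n : 0 < Gamma (n.+1%:R / 2 + s / 2) / Gamma (n.+1%:R / 2 : R).
  by rewrite divr_gt0// Gamma_gt0// ?addr_gt0// divr_gt0.
rewrite big_add1 big_mkord/= big_ord_recl ltr_wpDr//.
  apply: sumr_ge0 => n _.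
  by rewrite mulr_ge0 ?(ltW (G0 _))// divr_ge0// exprn_ge0.
by rewrite mulr_gt0// divr_gt0 ?exprn_gt0// ltr0n bin_gt0.
Qed.

Lemma powR_young (u th : R) : 0 <= u -> 0 < th < 1 ->
  u `^ th <= th * u + (1 - th).
Proof.
move=> u0 /andP[th0 th1].
have th10 : 0 < 1 - th by lra.
have := @conjugate_powR _ (u `^ th) 1 th^-1 (1 - th)^-1 (powR_ge0 _ _) ler01.
rewrite !invr_gt0 !invrK => /(_ th0 th10) => /(_ ltac:(ring)).
rewrite -powRrM mulfV ?gt_eqF// powRr1// powR1 mulr1 mul1r.
by rewrite mulrC.
Qed.

(** The pointwise bound (v t)^s <= (s/p) (v t)^p + (1 - s/p), which is [powR_young] at u = (v t)^p,
    integrated against t^(b - 1) exp(-t). *)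
Lemma Gamma_young v b s p : 0 < v -> 0 < b -> 0 < s -> s < p ->
  v `^ s * Gamma (b + s) <= s / p * (v `^ p * Gamma (b + p)) + (1 - s / p) * Gamma b.
Proof.
move=> v0 b0 s0 sp; have p0 : 0 < p by exact: lt_trans sp.
have th : 0 < s / p < 1 by rewrite divr_gt0//= ltr_pdivrMr// mul1r.
have [th0 th1] := andP th.
have k0 (x t : R) : (0 <= (t `^ (x - 1) * expR (- t))%:E)%E.
  by rewrite lee_fin mulr_ge0 ?powR_ge0 ?expR_ge0.
have mk (x : R) : measurable_fun (`]0, +oo[%classic : set R)
    (fun t : R => (t `^ (x - 1) * expR (- t))%:E).
  by apply: eq_measurable_fun (measurable_Gamma_kernel x 1 (D := _)) => t _;
    rewrite mul1r.
have c0 : 0 <= s / p * v `^ p by rewrite mulr_ge0 ?powR_ge0// ltW.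
have c1 : 0 <= 1 - s / p by lra.
have bs0 : 0 < b + s by exact: addr_gt0.
have bp0 : 0 < b + p by exact: addr_gt0.
rewrite mulrA -lee_fin EFinD !EFinM -(Gamma_integralE bs0).
rewrite -(Gamma_integralE bp0) -(Gamma_integralE b0) -EFinM.
rewrite -!ge0_integralZl_EFin ?powR_ge0//; try by move=> t _; exact: k0.
2-4: exact: mk.
rewrite -ge0_integralD//; last 4 first.
- by move=> t _; rewrite mule_ge0.
- by apply: emeasurable_funM => //; exact: mk.
- by move=> t _; rewrite mule_ge0.
- by apply: emeasurable_funM => //; exact: mk.
apply: ge0_le_integral => //.
- by move=> t _; rewrite mule_ge0// lee_fin powR_ge0.
- by apply: emeasurable_funM => //; exact: mk.
- by apply: emeasurable_funD; apply: emeasurable_funM => //; exact: mk.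
move=> t; rewrite /= in_itv/= andbT => t0.
rewrite -!EFinM -EFinD lee_fin.
have powD (x : R) : t `^ (b + x - 1) = t `^ x * t `^ (b - 1).
  by rewrite -powRD ?(gt_eqF t0) ?implybT//; congr (_ `^ _); ring.
have y := powR_young (powR_ge0 (v * t) p) th.
rewrite -powRrM (_ : p * (s / p) = s) in y; last by field; rewrite gt_eqF.
rewrite !powRM ?(ltW v0) ?(ltW t0)// in y.
have w0 : 0 <= t `^ (b - 1) * expR (- t) by rewrite mulr_ge0 ?powR_ge0 ?expR_ge0.
have := ler_wpM2r w0 y; rewrite !powD; lra.
Qed.

Lemma sum_bin_ge1 d : \sum_(1 <= n < d.+1) ('C(d, n)%:R / 2 ^+ d) = 1 - 2 ^- d :> R.
Proof.
have E : \sum_(n < d.+1) 'C(d, n)%:R = 2 ^+ d :> R.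
  rewrite -[2]/(1 + 1 : R) exprDn; apply: eq_bigr => n _.
  by rewrite !expr1n mulr1.
have d0 : 2 ^+ d != 0 :> R by rewrite expf_neq0.
have : \sum_(n < d.+1) ('C(d, n)%:R / 2 ^+ d) = 1 :> R.
  by rewrite -mulr_suml E divff.
rewrite big_ord_recl bin0 mul1r big_add1 big_mkord/= => E1.
by apply/esym/eqP; rewrite subr_eq addrC -[X in X == _]E1.
Qed.

(* The weights of [I0] add up to [1 - 2 ^- d], the probability that the rectified
   Gaussian vector is nonzero; this missing mass makes Jensen's inequality strict. *)
Lemma I0_moment_gt1 (sigma s p : R) d : 0 < sigma -> 0 < s -> s < p ->
  sigma `^ s * I0 s d = 1 -> 1 < sigma `^ p * I0 p d.
Proof.
move=> sg0 s0 sp H; have p0 : 0 < p by exact: lt_trans sp.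
(* Given n active coordinates, the squared norm is [v] times a Gamma variable of shape n/2, so a
   moment of order q of the norm is one of order q/2 there. *)
pose v : R := 2 * sigma ^+ 2.
have v0 : 0 < v by rewrite mulr_gt0// exprn_gt0.
pose a n : R := 'C(d, n)%:R / 2 ^+ d.
have IE q : sigma `^ q * I0 q d = \sum_(1 <= n < d.+1)
    (a n * (v `^ (q / 2) * Gamma (n%:R / 2 + q / 2) / Gamma (n%:R / 2))).
  have -> : v `^ (q / 2) = sigma `^ q * 2 `^ (q / 2).
    rewrite powRM ?sqr_ge0// mulrC -powR_mulrn ?(ltW sg0)// -powRrM.
    by congr (_ `^ _ * _); field.
  rewrite /I0 mulrA mulr_sumr; apply: eq_bigr => n _; rewrite /a; ring.
set X := sigma `^ p * I0 p d; pose th := s / p.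
have [th0 th1] : 0 < th /\ th < 1.
  by split; rewrite /th ?divr_gt0// ltr_pdivrMr// mul1r.
have : sigma `^ s * I0 s d <= th * X + (1 - th) * (1 - 2 ^- d).
  rewrite /X !IE -sum_bin_ge1 !mulr_sumr -big_split/= big_nat [leRHS]big_nat.
  apply: ler_sum => n /andP[n1 _].
  have b0 : 0 < n%:R / 2 :> R by rewrite divr_gt0// ltr0n.
  have Gb := Gamma_gt0 b0.
  have a0 : 0 <= a n by rewrite divr_ge0// exprn_ge0.
  have := @Gamma_young v (n%:R / 2) (s / 2) (p / 2) v0 b0.
  rewrite divr_gt0// ltr_pM2r ?invr_gt0// => /(_ isT sp).
  rewrite (_ : s / 2 / (p / 2) = th); last by rewrite /th; field; rewrite gt_eqF.
  rewrite -/(a n); set g := Gamma (n%:R / 2) in Gb *; set y := _ * Gamma _.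
  set z := v `^ (p / 2) * _ => Y.
  have -> : th * (a n * (z / g)) + (1 - th) * a n =
      a n * ((th * z + (1 - th) * g) / g) by field; rewrite gt_eqF.
  by rewrite ler_wpM2l// ler_wpM2r// invr_ge0 ltW.
rewrite H; have e0 : 0 < 2 ^- d :> R by rewrite invr_gt0 exprn_gt0.
move: (2 ^- d) e0 => e e0 K.
(* From 1 <= th X + (1 - th)(1 - e) follows th X >= th + (1 - th) e, and the last term is
   positive. *)
have {}K : th < th * X by nra.
by rewrite ltr_pMr in K.
Qed.

End moment_factor.

(** * The network *)

Section network.
Context {R : realType} {d : nat} {dT : measure_display} {T : measurableType dT}.
Variables (P : probability T R) (sigma : R).
Hypothesis sigma0 : 0 < sigma.
Variable W : nat -> 'I_d -> 'I_d -> {RV P >-> R}.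
Local Notation I := (nat * 'I_d * 'I_d)%type.
Hypothesis indW : mutually_independent P
  (fun i : I => (W i.1.1 i.1.2 i.2 : T -> R)).
Hypothesis lawW : forall k i j (B : set R), measurable B ->
  distribution P (W k i j) B = normal_prob 0 sigma B.
Variable x0 : 'cV[R]_d.

Let X (i : I) : {RV P >-> R} := W i.1.1 i.1.2 i.2.
Let Wf k i j := (W k i j : T -> R).
(** Layer [k] reads only the matrices [W 0], ..., [W (k - 1)], so all of [W k] is fresh for it. *)
Let before (k : nat) : set I := [set i | (i.1.1 < k)%N].

Lemma layerS k t i : layer 0 Wf x0 k.+1 t i 0 =
  prelu 0 (\sum_(j <- enum 'I_d) X (k, i, j) t * layer 0 Wf x0 k t j 0).
Proof.
by rewrite /= !mxE big_enum/=; congr prelu; apply: eq_bigr => j _; rewrite !mxE.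
Qed.

Lemma measurable_layer k i : measurable_fun setT
  (fun t : past X (before k) => layer 0 Wf x0 k t i 0).
Proof.
elim: k i => [|k IH] i /=; first exact: measurable_cst.
under eq_fun do rewrite -/(layer 0 Wf x0 k.+1 _) layerS.
apply: (measurableT_comp measurable_relu).
apply: measurable_sum_seq => j _; apply: measurable_funM.
  by apply: measurable_past; rewrite /before/=.
have sub : before k `<=` before k.+1 by move=> u /= /ltnW.
exact: (measurableT_comp (IH j) (measurable_past_sub sub)).
Qed.

Lemma enorm_powR (v : 'cV[R]_d) s :
  enorm v `^ s = (\sum_(i <- enum 'I_d) v i 0 ^+ 2) `^ (s / 2).
Proof.
rewrite /enorm big_enum/= -powR12_sqrt ?sumr_ge0//; last first.
  by move=> i _; exact: sqr_ge0.
by rewrite -powRrM mulrC.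
Qed.

Lemma moment_layerS s k : 0 < s ->
  (moment P 0 Wf x0 s k.+1 = (sigma `^ s * I0 s d)%:E * moment P 0 Wf x0 s k)%E.
Proof.
move=> s0; rewrite /moment; under eq_integral do rewrite enorm_powR.
under eq_integral do under eq_bigr do rewrite layerS.
pose f (z : 'I_d * 'I_d) : I := (k, z.1, z.2).
have injf : injective f by move=> [a b] [a' b'] [-> ->].
have mh : measurable_fun setT
    (fun z : past X (before k) * R => (z.2 `^ (s / 2))%:E).
  apply/measurable_EFinP; apply: (measurableT_comp (measurable_powR _)).
  exact: measurable_snd.
have fresh (l j : 'I_d) : l \in enum 'I_d -> j \in enum 'I_d ->
    ~ before k (f (l, j)).
  by move=> _ _; rewrite /before/= ltnn.
have lawX (i : I) (B : set R) : measurable B ->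
    distribution P (X i) B = normal_prob 0 sigma B.
  exact: lawW.
have E := @ge0_integral_fresh_matrix _ _ _ P _ X indW sigma sigma0 lawX
  (before k) _ _ f (enum 'I_d) (enum 'I_d) (fun j t => layer 0 Wf x0 k t j 0)
  _ injf (enum_uniq _) (enum_uniq _) fresh (@measurable_layer k) mh
  (fun z => powR_ge0 _ _).
rewrite [LHS]E size_enum_ord.
transitivity (\int[P]_t ((sigma `^ s * I0 s d)%:E *
    (enorm (layer 0 Wf x0 k t) `^ s)%:E))%E.
  apply: eq_integral => t _; rewrite iter_relu_smooth_powR//; last first.
    by rewrite mulr_ge0// ltW.
  rewrite -EFinM; congr EFin; rewrite powRM ?(ltW sigma0)// mulrAC.
  by rewrite /enorm big_enum.
rewrite ge0_integralZl_EFin//.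
- by move=> t _; rewrite lee_fin powR_ge0.
- apply/measurable_EFinP; apply: (measurableT_comp (measurable_powR _)).
  apply: (measurableT_comp (@measurable_sqrt R)).
  under eq_fun do rewrite -big_enum/=.
  apply: measurable_sum_seq => i _; apply: measurable_funX.
  exact: (measurableT_comp (@measurable_layer k i) (@measurable_past_id _ _ _ _ _ X _)).
- rewrite mulr_ge0 ?powR_ge0//; have [->|d0] := posnP d; last by rewrite ltW// I0_gt0.
  by rewrite /I0 big_geq// mulr0.
Qed.

Lemma moment_layer s k : 0 < s ->
  moment P 0 Wf x0 s k = (enorm x0 `^ s * (sigma `^ s * I0 s d) ^+ k)%:E.
Proof.
move=> s0; elim: k => [|k IH].
  by rewrite expr0 mulr1 -[RHS]mule1 -(probability_setT P) -integral_cst.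
by rewrite moment_layerS// IH -EFinM exprS mulrCA.
Qed.

End network.

Theorem mainTheorem1 (R : realType) (d : nat) (hd : (0 < d)%N)
  (dT : measure_display) (T : measurableType dT) (P : probability T R)
  (sigma : R) (hsigma : 0 < sigma)
  (W : nat -> 'I_d -> 'I_d -> {RV P >-> R})
  (hindep : mutually_independent P
              (fun ikj : nat * 'I_d * 'I_d => (W ikj.1.1 ikj.1.2 ikj.2 : T -> R)))
  (hgauss : forall k i j (B : set R), measurable B ->
              distribution P (W k i j) B = normal_prob 0 sigma B)
  (x0 : 'cV[R]_d) (s : R) (hs : 0 < s) :
  let Wf := fun k i j => (W k i j : T -> R) in
  (forall k : nat,
     moment P 0 Wf x0 s k = ((enorm x0 `^ s) * (sigma `^ s * I0 s d) ^+ k)%:E)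
  /\
  (x0 != 0 ->
     (* (i) *)
     (sigma = sigma_bar0 s d ->
        (forall k : nat, (1 <= k)%N -> moment P 0 Wf x0 s k = (enorm x0 `^ s)%:E)
        /\ (forall p : R, s < p ->
              exists (C c : R) (N : nat), 0 < C /\ 1 < c /\
                forall k : nat, (N <= k)%N -> ((C * c ^+ k)%:E <= moment P 0 Wf x0 p k)%E))
     /\
     (* (ii) *)
     (sigma < sigma_bar0 s d ->
        exists (C r : R) (N : nat), 0 < C /\ 0 <= r /\ r < 1 /\
          forall k : nat, (N <= k)%N -> (moment P 0 Wf x0 s k <= (C * r ^+ k)%:E)%E)
     /\
     (* (iii) *)
     (sigma_bar0 s d < sigma ->
        exists (C c : R) (N : nat), 0 < C /\ 1 < c /\
          forall k : nat, (N <= k)%N -> ((C * c ^+ k)%:E <= moment P 0 Wf x0 s k)%E)).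
Proof.
move=> Wf.
have momentE p k : 0 < p ->
    moment P 0 Wf x0 p k = (enorm x0 `^ p * (sigma `^ p * I0 p d) ^+ k)%:E.
  exact: moment_layer.
split=> [k|x00]; first exact: momentE.
have I00 := I0_gt0 hs hd.
have nx0 : 0 < enorm x0.
  rewrite sqrtr_gt0 lt_neqAle sumr_ge0 ?andbT; last by move=> i _; exact: sqr_ge0.
  apply: contra_neq x00 => /esym/eqP; rewrite psumr_eq0; last first.
    by move=> i _; exact: sqr_ge0.
  move=> /allP x00; apply/colP => i; rewrite mxE.
  by have := x00 i (mem_index_enum _); rewrite sqrf_eq0 => /eqP.
have nxp p : 0 < enorm x0 `^ p by exact: powR_gt0.
(* The threshold is the [sigma] at which the ratio sigma^s I0 equals 1. Moments being exactly
   geometric in [k], each case compares a ratio with 1, and the witnesses are the initial value and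
   the ratio, from [N = 0] on. *)
have sbE : sigma_bar0 s d `^ s = (I0 s d)^-1.
  by rewrite /sigma_bar0 -powRrM mulNr mulVf ?gt_eqF// powR_inv1// ltW.
have sb0 : 0 < sigma_bar0 s d by exact: powR_gt0.
split; [|split].
- move=> sgE.
  have f1 : sigma `^ s * I0 s d = 1 by rewrite sgE sbE mulVf// gt_eqF.
  split=> [k _|p sp]; first by rewrite momentE// f1 expr1n mulr1.
  exists (enorm x0 `^ p), (sigma `^ p * I0 p d), 0%N; split=> //.
  split; first exact: I0_moment_gt1 f1.
  by move=> k _; rewrite momentE//; exact: lt_trans sp.
- move=> sg_lt; exists (enorm x0 `^ s), (sigma `^ s * I0 s d), 0%N; split=> //.
  split; first by rewrite mulr_ge0 ?powR_ge0// ltW.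
  split; last by move=> k _; rewrite momentE.
  rewrite -ltr_pdivlMr// mul1r -sbE.
  by apply: gt0_ltr_powR => //; rewrite nnegrE ltW.
- move=> sg_gt; exists (enorm x0 `^ s), (sigma `^ s * I0 s d), 0%N; split=> //.
  split; last by move=> k _; rewrite momentE.
  rewrite -ltr_pdivrMr// mul1r -sbE.
  by apply: gt0_ltr_powR => //; rewrite nnegrE ltW.
Qed.
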